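(* Let $F$ be Richard Thompson's group, i.e. the group given by the presentation $\langle x_0,x_1,x_2,\ldots\mid x_j^{x_i}=x_{j+1}\ (i<j)\rangle$. The Dehn function $\Phi(n)$ of $F$ is quadratic, that is, $\Phi(n)\sim n^2$.
   Context: Notation: $a^b=b^{-1}ab$. The group $F$ is finitely presented; namely it is given by $\langle x_0,x_1\mid x_2^{x_1}=x_3,\ x_3^{x_1}=x_4\rangle$, where $x_{k+1}$ denotes $x_1^{x_0^k}$ for all $k\ge1$. Let $H=\langle a_1,\ldots,a_s\mid R_1,\ldots,R_t\rangle$ be a finite group presentation, let $\mathcal F_s$ be the free group on $a_1,\ldots,a_s$ and let $\mathcal N$ be the normal closure of $R_1,\ldots,R_t$ in $\mathcal F_s$. For a word $w\in\mathcal N$ let $k(w)$ be the smallest $k$ such that $w$ equals in $\mathcal F_s$ a product $U_1^{-1}R_{i_1}^{\pm1}U_1\cdots U_k^{-1}R_{i_k}^{\pm1}U_k$ with $U_i\in\mathcal F_s$ (equivalently, the smallest number of cells in a van Kampen diagram over the presentation with boundary label $w$). A function $p(n)$ is an isoperimetric function of the presentation if $k(w)\le p(n)$ for every word $w\in\mathcal N$ of length $\le n$. The Dehn function of the presentation is its smallest isoperimetric function. For functions $p,q:\mathbf N\to\mathbf N$, write $p\preceq q$ if there is a positive integer constant $C$ such that $p(n)\le Cq(Cn)+Cn$ for all $n$; write $p\sim q$ if $p\preceq q$ and $q\preceq p$. Dehn functions of different finite presentations of the same group are equivalent under $\sim$; the Dehn function of a finitely presented group is the Dehn function of any of its finite presentations,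 considered modulo $\sim$. *)

(* Defs.v *)
From HB Require Import structures.
From mathcomp Require Import all_boot.
From mathcomp Require Import boolp classical_sets.

Set Implicit Arguments.
Unset Strict Implicit.
Unset Printing Implicit Defensive.

Local Open Scope group_scope.

(* The letter (x, false) stands for x and (x, true) for its inverse; words need
   not be reduced. *)
Definition letter (X : Type) : Type := (X * bool)%type.
Definition word (X : Type) : Type := seq (letter X).

Definition linv (X : Type) (l : letter X) : letter X := (l.1, ~~ l.2).

Lemma linvK (X : Type) : involutive (@linv X).
Proof. by case=> x b; rewrite /linv /= negbK. Qed.

(* The free group on X, realized on reduced words: push multiplies a reduced
   word by a letter on the left. *)
Definition reduced (X : choiceType) (w : word X) : bool :=
  sorted (fun a b => b != linv a) w.

Definition push (X : choiceType) (l : letter X) (w : word X) : word X :=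
  if w is m :: w' then if m == linv l then w' else l :: w else [:: l].

Definition reduce (X : choiceType) (w : word X) : word X :=
  foldr (@push X) [::] w.

Lemma push_reduced (X : choiceType) (l : letter X) (w : word X) :
  reduced w -> reduced (push l w).
Proof.
case: w => [|m w] //= rw; case: eqP => [_|/eqP ml].
  by case: w rw => //= a w /andP[].
by rewrite /reduced /= ml.
Qed.

Lemma foldr_push_reduced (X : choiceType) (u v : word X) :
  reduced v -> reduced (foldr (@push X) v u).
Proof. by move=> rv; elim: u => //= l u IH; exact: push_reduced. Qed.

Lemma reduce_reduced (X : choiceType) (w : word X) : reduced (reduce w).
Proof. exact: foldr_push_reduced. Qed.

Lemma reduce_id (X : choiceType) (w : word X) : reduced w -> reduce w = w.
Proof.
elim: w => //= l w IH rw; rewrite -/(reduce w) IH; last first.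
  by move: rw; rewrite /reduced; case: (w) => //= a u /andP[].
by case: w rw {IH} => //= m w /andP[/negbTE ->].
Qed.

Lemma pushK (X : choiceType) (l : letter X) (w : word X) :
  reduced w -> push l (push (linv l) w) = w.
Proof.
case: w => [|m w] /=; first by rewrite eqxx.
rewrite linvK; case: eqP => [->|_] rw; last by rewrite /= eqxx.
by case: w rw => //= a w /andP[/negbTE ->].
Qed.

Lemma foldr_push_push (X : choiceType) (l : letter X) (u v : word X) :
  reduced v -> foldr (@push X) v (push l u) = push l (foldr (@push X) v u).
Proof.
move=> rv; case: u => //= m u; case: eqP => //= ->.
by rewrite pushK // foldr_push_reduced.
Qed.

Lemma foldr_push_foldr (X : choiceType) (u v w : word X) :
  reduced w ->
  foldr (@push X) w (foldr (@push X) v u) =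
  foldr (@push X) (foldr (@push X) w v) u.
Proof. by move=> rw; elim: u => //= l u IH; rewrite foldr_push_push // IH. Qed.

Record free_group (X : choiceType) : Type :=
  FreeGroup { fgval : word X; fgvalP : reduced fgval }.

HB.instance Definition _ (X : choiceType) := [isSub for @fgval X].
HB.instance Definition _ (X : choiceType) :=
  [Choice of free_group X by <:].

Definition of_word (X : choiceType) (w : word X) : free_group X :=
  FreeGroup (reduce_reduced w).

Definition fg_one (X : choiceType) : free_group X := of_word [::].
Definition fg_mul (X : choiceType) (g h : free_group X) : free_group X :=
  of_word (fgval g ++ fgval h).
Definition fg_inv (X : choiceType) (g : free_group X) : free_group X :=
  of_word (rev (map (@linv X) (fgval g))).

Lemma reduce_cat (X : choiceType) (u v : word X) :
  reduce (u ++ v) = foldr (@push X) (reduce v) u.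
Proof. by rewrite /reduce foldr_cat. Qed.

Lemma fg_mulE (X : choiceType) (g h : free_group X) :
  fgval (fg_mul g h) = foldr (@push X) (fgval h) (fgval g).
Proof. by rewrite /= reduce_cat reduce_id ?fgvalP. Qed.

Lemma fg_mulA (X : choiceType) : associative (@fg_mul X).
Proof.
move=> a b c; apply: val_inj.
by rewrite [LHS]fg_mulE [RHS]fg_mulE !fg_mulE foldr_push_foldr ?fgvalP.
Qed.

Lemma fg_mul1g (X : choiceType) : left_id (fg_one X) (@fg_mul X).
Proof. by move=> a; apply: val_inj; rewrite [LHS]fg_mulE. Qed.

Lemma fg_mulg1 (X : choiceType) : right_id (fg_one X) (@fg_mul X).
Proof.
by move=> a; apply: val_inj; rewrite [LHS]fg_mulE; exact: reduce_id (fgvalP a).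
Qed.

Lemma foldr_pushV (X : choiceType) (u v : word X) :
  reduced v ->
  foldr (@push X) (foldr (@push X) v u) (rev (map (@linv X) u)) = v.
Proof.
move=> rv; elim: u => //= l u IH; rewrite rev_cons foldr_rcons.
by rewrite -{2}(linvK l) pushK ?foldr_push_reduced.
Qed.

Lemma fg_mulVg (X : choiceType) :
  left_inverse (fg_one X) (@fg_inv X) (@fg_mul X).
Proof.
move=> a; apply: val_inj; rewrite [LHS]fg_mulE /= foldr_push_foldr ?fgvalP //=.
by rewrite -{1}[fgval a](reduce_id (fgvalP a)) foldr_pushV.
Qed.

Lemma fg_mulgV (X : choiceType) :
  right_inverse (fg_one X) (@fg_inv X) (@fg_mul X).
Proof.
move=> a; rewrite -[LHS]fg_mul1g -{1}(fg_mulVg (fg_inv a)).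
by rewrite -fg_mulA [X in fg_mul _ X]fg_mulA fg_mulVg fg_mul1g fg_mulVg.
Qed.

HB.instance Definition _ (X : choiceType) := isGroup.Build (free_group X)
  (@fg_mulA X) (@fg_mul1g X) (@fg_mulg1 X) (@fg_mulVg X) (@fg_mulgV X).

Definition gen (X : choiceType) (x : X) : free_group X :=
  of_word [:: (x, false)].

Lemma of_word_cat (X : choiceType) (u v : word X) :
  of_word (u ++ v) = of_word u * of_word v.
Proof.
apply: val_inj; rewrite [RHS]fg_mulE /= reduce_cat foldr_push_foldr //.
exact: reduce_reduced.
Qed.

Lemma of_wordE (X : choiceType) (w : word X) :
  of_word w = \prod_(l <- w) (if l.2 then (gen l.1)^-1 else gen l.1).
Proof.
elim: w => [|[x b] w IH]; first by rewrite big_nil.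
rewrite big_cons -IH -cat1s of_word_cat; congr (_ * _).
by case: b => //; apply: val_inj.
Qed.

Definition normal_subgroup (G : groupType) (N : set G) : Prop :=
  [/\ N 1, forall x y, N x -> N y -> N (x * y),
      forall x, N x -> N x^-1 & forall x y, N x -> N (x ^ y)].

Definition normal_closure (G : groupType) (R : set G) : set G :=
  [set g | forall N : set G, normal_subgroup N -> (R `<=` N)%classic -> N g].

Lemma normal_closure_normal (G : groupType) (R : set G) :
  normal_subgroup (normal_closure R).
Proof.
split=> [N [] //|x y cx cy N nN RN|x cx N nN RN|x y cx N nN RN].
- by case: (nN) => _ + _ _; apply; [exact: cx|exact: cy].
- by case: (nN) => _ _ + _; apply; exact: cx.
- by case: (nN) => _ _ _; apply; exact: cx.
Qed.

Lemma sub_normal_closure (G : groupType) (R : set G) :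
  (R `<=` normal_closure R)%classic.
Proof. by move=> r Rr N _; apply. Qed.

(* The quotient of G by the normal closure of R. *)
Definition ncl_rel (G : groupType) (R : set G) (x y : G) : bool :=
  `[< normal_closure R (x / y) >].

Lemma ncl_rel_refl (G : groupType) (R : set G) : reflexive (ncl_rel R).
Proof.
by move=> x; apply/asboolP; rewrite mulgV; case: (normal_closure_normal R).
Qed.

Lemma ncl_rel_sym (G : groupType) (R : set G) : symmetric (ncl_rel R).
Proof.
case: (normal_closure_normal R) => _ _ nV _ x y.
by apply/asboolP/asboolP => /nV; rewrite invgF.
Qed.

Lemma ncl_rel_trans (G : groupType) (R : set G) : transitive (ncl_rel R).
Proof.
case: (normal_closure_normal R) => _ nM _ _ y x z.
move=> /asboolP xy /asboolP yz; apply/asboolP.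
by have := nM _ _ xy yz; rewrite mulgA mulgVK.
Qed.

Canonical ncl_equiv (G : groupType) (R : set G) : equiv_rel G :=
  EquivRel (ncl_rel R) (@ncl_rel_refl G R) (@ncl_rel_sym G R)
           (@ncl_rel_trans G R).

Definition quot_group (G : groupType) (R : set G) : Type :=
  {eq_quot (ncl_equiv R)}%qT.

HB.instance Definition _ (G : groupType) (R : set G) :=
  Choice.on (quot_group R).

Definition qproj (G : groupType) (R : set G) (x : G) : quot_group R :=
  (\pi_({eq_quot (ncl_equiv R)}) x)%qT.
Definition qrepr (G : groupType) (R : set G) (a : quot_group R) : G :=
  repr (a : {eq_quot (ncl_equiv R)}%qT).

Lemma qreprK (G : groupType) (R : set G) : cancel (@qrepr G R) (@qproj G R).
Proof. exact: reprK. Qed.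

Lemma qprojP (G : groupType) (R : set G) (x y : G) :
  qproj R x = qproj R y <-> normal_closure R (x / y).
Proof.
split=> [|xy].
  by move=> /(@eqmodP _ (ncl_equiv R))/asboolP.
by apply/(@eqmodP _ (ncl_equiv R)); exact/asboolP.
Qed.

Definition q_one (G : groupType) (R : set G) : quot_group R := qproj R 1.
Definition q_mul (G : groupType) (R : set G) (a b : quot_group R) :
  quot_group R := qproj R (qrepr a * qrepr b).
Definition q_inv (G : groupType) (R : set G) (a : quot_group R) :
  quot_group R := qproj R (qrepr a)^-1.

Lemma q_mulE (G : groupType) (R : set G) (x y : G) :
  q_mul (qproj R x) (qproj R y) = qproj R (x * y).
Proof.
apply/qprojP; case: (normal_closure_normal R) => _ nM nV nJ.
have /qprojP xN : qproj R (qrepr (qproj R x)) = qproj R x by rewrite qreprK.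
have /qprojP yN : qproj R (qrepr (qproj R y)) = qproj R y by rewrite qreprK.
have := nM _ _ (nJ _ (qrepr (qproj R x))^-1 yN) xN.
by rewrite /conjg invgK invgM !mulgA mulgVK.
Qed.

Lemma q_invE (G : groupType) (R : set G) (x : G) :
  q_inv (qproj R x) = qproj R x^-1.
Proof.
apply/qprojP; case: (normal_closure_normal R) => _ nM nV nJ.
have /qprojP xN : qproj R (qrepr (qproj R x)) = qproj R x by rewrite qreprK.
have := nJ _ x (nV _ xN).
by rewrite /conjg invgF invgK !mulgA mulVg mul1g.
Qed.

Lemma q_mulA (G : groupType) (R : set G) : associative (@q_mul G R).
Proof.
by move=> a b c; rewrite -(qreprK a) -(qreprK b) -(qreprK c) !q_mulE mulgA.
Qed.

Lemma q_mul1g (G : groupType) (R : set G) : left_id (q_one R) (@q_mul G R).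
Proof. by move=> a; rewrite -(qreprK a) q_mulE mul1g. Qed.

Lemma q_mulg1 (G : groupType) (R : set G) : right_id (q_one R) (@q_mul G R).
Proof. by move=> a; rewrite -(qreprK a) q_mulE mulg1. Qed.

Lemma q_mulVg (G : groupType) (R : set G) :
  left_inverse (q_one R) (@q_inv G R) (@q_mul G R).
Proof. by move=> a; rewrite -(qreprK a) q_invE q_mulE mulVg. Qed.

Lemma q_mulgV (G : groupType) (R : set G) :
  right_inverse (q_one R) (@q_inv G R) (@q_mul G R).
Proof. by move=> a; rewrite -(qreprK a) q_invE q_mulE mulgV. Qed.

HB.instance Definition _ (G : groupType) (R : set G) :=
  isGroup.Build (quot_group R)
    (@q_mulA G R) (@q_mul1g G R) (@q_mulg1 G R) (@q_mulVg G R) (@q_mulgV G R).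

Lemma qprojM (G : groupType) (R : set G) :
  {morph qproj R : x y / x * y >-> x * y}.
Proof. by move=> x y; rewrite [RHS]q_mulE. Qed.

(* The group given by the presentation < X | r = 1 for r in R >. *)
Definition presented_group (X : choiceType) (R : set (free_group X)) :
  groupType := quot_group R.

(* The relation x_j ^ x_i = x_(j+1) is encoded by the relator
   x_j ^ x_i / x_(j+1); note that x ^ y is y^-1 * x * y. *)
Definition thompson_relators : set (free_group nat) :=
  [set r | exists i j : nat,
     (i < j)%N /\ r = (gen j ^ gen i) / gen j.+1].

Definition thompson_group : groupType := presented_group thompson_relators.

Definition isomorphic_groups (G H : groupType) : Prop :=
  exists2 f : G -> H, {morph f : x y / x * y >-> x * y} & bijective f.

Record fin_presentation : Type := FinPresentation {
  ngen : nat;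
  nrel : nat;
  relator : 'I_nrel -> free_group 'I_ngen
}.

Definition relators (P : fin_presentation) : set (free_group 'I_(ngen P)) :=
  range (@relator P).

Definition presents (P : fin_presentation) (G : groupType) : Prop :=
  isomorphic_groups (presented_group (@relators P)) G.

Definition finitely_presented (G : groupType) : Prop :=
  exists P : fin_presentation, presents P G.

Definition in_kernel (P : fin_presentation) (w : word 'I_(ngen P)) : Prop :=
  normal_closure (@relators P) (of_word w).

(* The triple (i, e, U) stands for U^-1 * R_i^(+-1) * U, the exponent being -1
   when e is true. *)
Definition cell (P : fin_presentation)
    (c : 'I_(nrel P) * bool * free_group 'I_(ngen P)) :
    free_group 'I_(ngen P) :=
  (if c.1.2 then (relator c.1.1)^-1 else relator c.1.1) ^ c.2.

Definition is_cell_product (P : fin_presentation) (k : nat)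
    (w : word 'I_(ngen P)) : Prop :=
  exists s : seq ('I_(nrel P) * bool * free_group 'I_(ngen P)),
    size s = k /\ of_word w = \prod_(c <- s) cell c.

(* The number k(w); it has the junk value 0 for words w outside the normal
   closure of the relators. *)
Definition area (P : fin_presentation) (w : word 'I_(ngen P)) : nat :=
  if pselect (exists k, `[< is_cell_product k w >]) is left h
  then ex_minn h else 0.

Definition isoperimetric_function (P : fin_presentation) (p : nat -> nat) :
    Prop :=
  forall (n : nat) (w : word 'I_(ngen P)),
    in_kernel w -> (size w <= n)%N -> (area w <= p n)%N.

Definition is_dehn_function (P : fin_presentation) (Phi : nat -> nat) : Prop :=
  isoperimetric_function P Phi /\
  forall p : nat -> nat, isoperimetric_function P p ->
    forall n : nat, (Phi n <= p n)%N.

Definition dehn_le (p q : nat -> nat) : Prop :=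
  exists C : nat, (0 < C)%N /\
    forall n : nat, (p n <= C * q (C * n) + C * n)%N.

Definition dehn_equiv (p q : nat -> nat) : Prop :=
  dehn_le p q /\ dehn_le q p.

Lemma in_kernelP (P : fin_presentation) (w : word 'I_(ngen P)) :
  in_kernel w <-> exists k, is_cell_product k w.
Proof.
pose N : set (free_group 'I_(ngen P)) :=
  [set g | exists s : seq ('I_(nrel P) * bool * free_group 'I_(ngen P)),
     g = \prod_(c <- s) cell c]%classic.
split=> [|[_ [s [_ sw]]]].
  have NM x y : N x -> N y -> N (x * y).
    by move=> [s ->] [t ->]; exists (s ++ t); rewrite big_cat.
  have N1 : N 1 by exists [::]; rewrite big_nil.
  have Ncell c : N (cell c) by exists [:: c]; rewrite big_seq1.
  have NcellV c : N (cell c)^-1.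
    suff -> : (cell c)^-1 = cell (c.1.1, ~~ c.1.2, c.2) by [].
    by rewrite /cell /=; case: c => -[i []] U /=; rewrite -conjVg ?invgK.
  have NV x : N x -> N x^-1.
    move=> [s ->]; elim: s => [|c s IH]; first by rewrite big_nil invg1.
    by rewrite big_cons invgM; exact: NM.
  have NJ x y : N x -> N (x ^ y).
    move=> [s ->]; elim: s => [|c s IH]; first by rewrite big_nil conj1g.
    rewrite big_cons conjMg; apply: NM => //.
    suff -> : cell c ^ y = cell (c.1, c.2 * y) by [].
    by rewrite /cell /= conjgM.
  move=> /(_ N) [||s sw]; [by split| |by exists (size s), s].
  by move=> _ [i _ <-]; exists [:: (i, false, 1)]; rewrite big_seq1 /cell conjg1.
case: (normal_closure_normal (@relators P)) => n1 nM nV nJ.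
rewrite /in_kernel sw; elim: s {sw} => [|[[i e] U] s IH].
  by rewrite big_nil.
rewrite big_cons; apply: nM => //; apply: nJ => /=.
have ri : normal_closure (@relators P) (relator i).
  by apply: sub_normal_closure; exists i.
by case: e => //; exact: nV.
Qed.

Lemma areaP (P : fin_presentation) (w : word 'I_(ngen P)) :
  in_kernel w ->
  is_cell_product (area w) w /\
  forall k, is_cell_product k w -> (area w <= k)%N.
Proof.
move=> /in_kernelP [k kw]; rewrite /area; case: pselect => [h|[]]; last first.
  by exists k; exact/asboolP.
case: ex_minnP => m /asboolP mw min_m; split=> // j jw.
by apply: min_m; exact/asboolP.
Qed.

Lemma dehn_function_exists (P : fin_presentation) :
  exists Phi : nat -> nat, is_dehn_function P Phi.
Proof.
pose a (w : word 'I_(ngen P)) := if `[< in_kernel w >] then area w else 0%N.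
exists (fun n => \max_(m < n.+1) \max_(t : m.-tuple (letter 'I_(ngen P))) a t)%N.
split=> [n w kw wn|p pP n].
  have -> : area w = a (in_tuple w) by rewrite /a /= asboolT.
  apply: leq_trans (leq_bigmax (Ordinal (wn : (size w < n.+1)%N))) => /=.
  exact: (leq_bigmax (in_tuple w)).
apply/bigmax_leqP => m _; apply/bigmax_leqP => t _; rewrite /a.
case: asboolP => // kt; apply: pP => //.
by rewrite size_tuple -ltnS.
Qed.

(* Main.v *)
(* Write t = x_0 and y_j = x_(j+1) = y ^ (t ^+ j).

   Lower bound.  The map of F onto Z^2 lifts, on the free group on the generators
   of a presentation, to a map to the Heisenberg group. Relators become central
   elements of bounded size, whereas for the commuting elements z = y t^-1 and
   y_1 the word [z^n, y_1^n] has central coordinate of size n^2.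

   Upper bound.  A word of length n is halved, each half is brought to the form
   t^a p q^-1 t^-b, where p and q are nondecreasing products of the y_j of linear
   size, and the two fractions are multiplied. If this costs O(n^2), then the total
   cost satisfies A(n) <= 2 A(n/2) + O(n^2), hence is quadratic; if the word is
   trivial in F, then p = q in the end. To multiply two fractions one takes a common
   multiple and merges nondecreasing products. By halving again, merging reduces to
   commuting a product supported on the left of a point with one supported on the
   right of it. This is cheap once both are rewritten in terms of two generators
   with support on the respective side. The rewriting is done by halving too:
   X(n) <= 3 X(n/2) + O(n^2), where O(n^2) pays for replacing conjugation by t^g by
   conjugation by y^g. Finally, this replacement is possible because the element
   which builds a balanced tree with g carets is a short word in generators on the
   right, and its product with t^-g is a short word in generators on the left. *)
Require Import Defs.
From HB Require Import structures.
From mathcomp Require Import all_boot all_order all_algebra zify ring lra.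
From mathcomp Require Import boolp classical_sets.

Set Implicit Arguments.
Unset Strict Implicit.
Unset Printing Implicit Defensive.

(** * Bi-invariant costs and words *)

Ltac gnorm := rewrite ?conjgE ?invgM ?invgK ?invg1 ?mulg1 ?mul1g;
  repeat (progress rewrite ?(invgM, invgK, invg1, mulgA, mulgK, mulgVK, mulgV,
    mulVg, mul1g, mulg1)).

Section Cost.
Local Open Scope group_scope.

(** Read [N k g] as: g is a product of at most k conjugates of relators and their inverses. When
    [N k g] is [g = 1], the same estimates become identities in the group. *)
Record cost_axioms (G : groupType) (N : nat -> G -> Prop) : Prop := CostAxioms {
  cost1 : N 0 1;
  costM : forall k l g h, N k g -> N l h -> N (k + l)%N (g * h);
  costV : forall k g, N k g -> N k g^-1;
  costJ : forall k g u, N k g -> N k (g ^ u);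
  costW : forall k l g, (k <= l)%N -> N k g -> N l g }.

Variables (G : groupType) (N : nat -> G -> Prop).
Hypothesis costN : cost_axioms N.
Implicit Types (g h u v a b : G) (k l m n : nat).

Definition near k g h : Prop := N k (g / h).

Lemma nearW k l g h : near k g h -> (k <= l)%N -> near l g h.
Proof. by move=> ngh kl; apply: (costW costN kl). Qed.

Lemma near_refl k g : near k g g.
Proof. by apply: (costW costN (leq0n k)); rewrite mulgV; exact: cost1. Qed.

Lemma near_eq k g h : g = h -> near k g h.
Proof. by move=> ->; exact: near_refl. Qed.

Lemma near_sym k g h : near k g h -> near k h g.
Proof. by move=> /(costV costN); rewrite invgF. Qed.

Lemma near_trans k l g h u : near k g h -> near l h u -> near (k + l) g u.
Proof. by move=> gh hu; have := costM costN gh hu; rewrite mulgA mulgVK. Qed.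

Lemma nearM k l g h u v : near k g h -> near l u v -> near (k + l) (g * u) (h * v).
Proof.
move=> gh uv; have := costM costN (costJ costN g^-1 uv) gh.
by rewrite addnC /near; congr (N _ _); gnorm.
Qed.

Lemma nearMl k g u v : near k u v -> near k (g * u) (g * v).
Proof. by move=> uv; have := nearM (near_refl 0 g) uv. Qed.

Lemma nearMr k g u v : near k u v -> near k (u * g) (v * g).
Proof. by move=> uv; have := nearM uv (near_refl 0 g); rewrite addn0. Qed.

Lemma nearV k g h : near k g h -> near k g^-1 h^-1.
Proof.
move=> /near_sym gh; have := costJ costN h gh.
by rewrite /near; congr (N _ _); gnorm.
Qed.

Lemma nearJ k g h u : near k g h -> near k (g ^ u) (h ^ u).
Proof.
move=> gh; have := costJ costN u gh.
by rewrite /near; congr (N _ _); gnorm.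
Qed.

Lemma nearJJ k l g h u v :
  near k g h -> near l u v -> near (k + l + l) (g ^ u) (h ^ v).
Proof.
move=> gh uv; rewrite !conjgE.
apply: nearW (nearM (nearV uv) (nearM gh uv)) _; lia.
Qed.

Lemma nearJV k g u : near k (g ^ u) g -> near k (g ^ u^-1) g.
Proof. by move=> gu; have := nearJ u^-1 (near_sym gu); rewrite conjgK. Qed.

Lemma near_comm k g u : near k (g ^ u) g -> near k (u ^ g) u.
Proof.
move=> gu; have := costJ costN g (costV costN (costJ costN u^-1 gu)).
by rewrite /near; congr (N _ _); gnorm.
Qed.

Lemma near_comm_mul k g u : near k (g ^ u) g -> near k (g * u) (u * g).
Proof. by move=> gu; rewrite conjgC; apply: nearMl. Qed.

End Cost.

Ltac nlia :=
  repeat match goal with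
  | H : near _ _ _ _ |- _ => clear H
  | H : is_true (all _ _) |- _ => clear H
  | H : is_true (sorted _ _) |- _ => clear H
  | H : forall _, _ |- _ => clear H
  end; lia.

(* Words in two letters T and Y; [ev a b w] is the value of [w] at T = a, Y = b. *)
Notation lT := (false, false).
Notation lTV := (false, true).
Notation lY e := (true, e).

Section Words.
Local Open Scope group_scope.

Definition evl (G : groupType) (a b : G) (l : letter bool) : G :=
  let g := if l.1 then b else a in if l.2 then g^-1 else g.

Definition ev (G : groupType) (a b : G) (w : word bool) : G :=
  foldr (fun l g => evl a b l * g) 1 w.

Variable G : groupType.
Implicit Types (a b g u : G) (w : word bool).

Lemma ev_cat a b w1 w2 : ev a b (w1 ++ w2) = ev a b w1 * ev a b w2.
Proof. by elim: w1 => [|l w1 /= ->]; rewrite ?mul1g ?mulgA. Qed.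

Lemma ev_cons a b l w : ev a b (l :: w) = evl a b l * ev a b w.
Proof. by []. Qed.

Lemma evlJ a b u l : evl a b l ^ u = evl (a ^ u) (b ^ u) l.
Proof. by case: l => [[] []] /=; rewrite /evl /= ?conjVg. Qed.

Lemma evJ a b u w : ev a b w ^ u = ev (a ^ u) (b ^ u) w.
Proof.
by elim: w => [|l w IH] /=; rewrite ?conj1g // conjMg IH evlJ.
Qed.

Lemma ev_nseqT a b n : ev a b (nseq n lT) = a ^+ n.
Proof. by elim: n => //= n ->; rewrite /evl /= expgS. Qed.

Lemma ev_nseqTV a b n : ev a b (nseq n lTV) = a ^- n.
Proof. by elim: n => [|n /= ->]; rewrite /evl /= ?invg1 // expgSr invgM. Qed.

Variable N : nat -> G -> Prop.
Hypothesis costN : cost_axioms N.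
Notation near := (near N).

Lemma evl_near k a b a' b' l :
  near k a a' -> near k b b' -> near k (evl a b l) (evl a' b' l).
Proof. by case: l => [[] []] na nb; rewrite /evl //=; apply: nearV. Qed.

Lemma ev_near k a b a' b' w : near k a a' -> near k b b' ->
  near (k * size w) (ev a b w) (ev a' b' w).
Proof.
move=> na nb; elim: w => [|l w IH] /=; first exact: near_refl.
by rewrite mulnS; apply: nearM => //; apply: evl_near.
Qed.

Lemma ev_conj_near k g a b w : near k (g ^ a) g -> near k (g ^ b) g ->
  near (k * size w) (g ^ ev a b w) g.
Proof.
move=> na nb; elim: w => [|l w IH] /=; first by rewrite conjg1; exact: near_refl.
rewrite mulnS conjgM; apply: (near_trans costN _ IH); apply: (nearJ costN).
by case: l => [[] []]; rewrite /evl //=; apply: nearJV.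
Qed.

(** One word passes through the other at the price of one commutation of generators per pair of
    letters. *)
Lemma ev_ev_comm k a b a' b' w (v : word bool) :
  near k (a ^ a') a -> near k (b ^ a') b -> near k (a ^ b') a ->
  near k (b ^ b') b ->
  near (k * size w * size v) (ev a b w ^ ev a' b' v) (ev a b w).
Proof.
by move=> *; apply: ev_conj_near; rewrite evJ; apply: ev_near.
Qed.

End Words.

(** * Thompson sequences *)

Section ThompsonSequences.
Local Open Scope group_scope.
Variables (G : groupType) (N : nat -> G -> Prop).
Hypothesis costN : cost_axioms N.
Notation near := (near N).
Implicit Types (x : nat -> G) (c : nat -> nat).

(** The price depends on the gap d only, so every tail of the sequence satisfies the same bounds. *)
Definition tseq c x : Prop :=
  forall i d, near (c d) (x (i + d.+1)%N ^ x i) (x (i + d.+2)%N).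

Definition shift x : nat -> G := fun i => x i.+1.

Lemma tseq_shift c x : tseq c x -> tseq c (shift x).
Proof. by move=> hx i d; rewrite /shift -!addSn; exact: hx. Qed.

(* Bounds the cost of x_j ^ x_i = x_(j+1) for j <= i + 6, the only case in which
   the relations are used directly. *)
Definition cbound c : nat := \sum_(d < 6) c d.

Lemma tseq_near c x i j : tseq c x -> (i < j <= i + 6)%N ->
  near (cbound c) (x j ^ x i) (x j.+1).
Proof.
move=> hx /andP[ij ji]; have := hx i (j - i.+1)%N.
rewrite !addnS -!addSn subnKC // addSn subnKC // => /nearW; apply => //.
have lt6 : (j - i.+1 < 6)%N by lia.
by rewrite /cbound (bigD1 (Ordinal lt6)) //= leq_addr.
Qed.

Definition zof x : G := x 1%N / x 0%N.

(** The generators under the reflection of the line, which exchanges t with t^-1 and y with z = y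
    t^-1. On the line, y is supported to the right of a point and z to the left of one. *)
Definition mirror x : nat -> G :=
  fun i => if i is j.+1 then zof x ^ (x 0%N ^- j) else (x 0%N)^-1.

Definition mirror_cost c d : nat :=
  (\sum_(i < d.+1) c i + c d + \sum_(i < d.+2) c i)%N.

Lemma tseq_expg c x e : tseq c x ->
  near (\sum_(i < e) c i) (x 1%N ^ x 0%N ^+ e) (x e.+1).
Proof.
move=> hx; elim: e => [|e IH]; first by rewrite conjg1; exact: near_refl.
rewrite big_ord_recr /= expgSr conjgM.
by apply: (near_trans costN (nearJ costN _ IH)); exact: (hx 0%N e).
Qed.

(** As z = y t^-1, the mirrored relation amounts to y commuting with z ^ t^-(d+1), that is, to z
    commuting with y ^ t^(d+1). This holds because y and t both move y ^ t^(d+1) one step further;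
    [mirror_cost] adds up the three comparisons. *)
Lemma tseq_mirror c x : tseq c x -> tseq (mirror_cost c) (mirror x).
Proof.
move=> hx [|i] d.
  apply: near_eq => //=.
  by rewrite -conjgM expgS invgM.
rewrite !addSn /=; set t := x 0%N; set z := zof x.
have -> : z ^ t ^- (i + d.+1) = (z ^ t ^- d.+1) ^ t ^- i.
  by rewrite -conjgM -invgM -expgnDr.
have -> : z ^ t ^- (i + d.+2) = (z ^ t ^- d.+2) ^ t ^- i.
  by rewrite -conjgM -invgM -expgnDr.
rewrite -conjJg; apply: nearJ => //.
suff H : near (mirror_cost c d) ((z ^ t ^- d.+1) ^ x 1%N) (z ^ t ^- d.+1).
  have -> : z ^ t ^- d.+2 = (z ^ t ^- d.+1) ^ t^-1.
    by rewrite -conjgM -invgM -expgS.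
  by rewrite [X in near _ X _]conjgM; exact: nearJ.
suff H : near (mirror_cost c d) ((x 1%N ^ t ^+ d.+1) ^ z) (x 1%N ^ t ^+ d.+1).
  have := nearJ costN (t ^- d.+1) (near_comm costN H).
  by rewrite conjJg conjgK.
rewrite conjgM; have e1 := tseq_expg d.+1 hx; have e2 := tseq_expg d.+2 hx.
have := nearJ costN (x 1%N) e1 => /near_trans /(_ (hx 1%N d)) - /(_ costN) e3.
have := near_trans costN e3 (near_sym costN e2) => /(nearJ costN t^-1).
suff -> : (x 1%N ^ x 0%N ^+ d.+2) ^ t^-1 = x 1%N ^ t ^+ d.+1 by [].
by rewrite expgSr conjgM conjgK.
Qed.

Section Commutations.
Variables (c : nat -> nat) (x : nat -> G).
Hypothesis hx : tseq c x.
Let K := cbound c.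

Lemma comm_z j : (2 <= j <= 5)%N -> near (2 * K) (x j ^ zof x) (x j).
Proof.
move=> jb; rewrite conjgM mul2n -addnn.
have j1 : near K (x j ^ x 1%N) (x j.+1) by apply: tseq_near => //; lia.
have j0 : near K (x j ^ x 0%N) (x j.+1) by apply: tseq_near => //; lia.
have := nearJ costN (x 0%N)^-1 (near_trans costN j1 (near_sym costN j0)).
by rewrite conjgK.
Qed.

(** [mirror x 2] is t z t^-1: conjugation by it goes up to x_(j+1), uses the commutation with z
    there, and comes back. *)
Lemma comm_zz j : (2 <= j <= 4)%N -> near (4 * K) (x j ^ mirror x 2%N) (x j).
Proof.
move=> jb; have j0 : near K (x j ^ x 0%N) (x j.+1) by apply: tseq_near => //; lia.
have jz : near (2 * K) (x j.+1 ^ zof x) (x j.+1) by apply: comm_z; lia.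
have := near_trans costN (nearJ costN (zof x) j0) jz.
move=> /(near_trans costN) /(_ (near_sym costN j0)) /(nearJ costN (x 0%N)^-1).
rewrite conjgK -!conjgM => H.
suff -> : x j ^ mirror x 2%N = x j ^ (x 0%N * (zof x / x 0%N)).
  by apply: (nearW costN H); lia.
by congr (_ ^ _); rewrite /mirror expg1; gnorm.
Qed.

Lemma mirror1 : mirror x 1%N = zof x.
Proof. by rewrite /mirror expg0 invg1 conjg1. Qed.

End Commutations.

End ThompsonSequences.

(** * Trees *)

Inductive tree : Type := Leaf | Node of tree & tree.

Fixpoint carets (T : tree) : nat :=
  if T is Node A B then (carets A + carets B).+1 else 0.

Fixpoint flip (T : tree) : tree :=
  if T is Node A B then Node (flip B) (flip A) else Leaf.

Fixpoint balanced (T : tree) : bool :=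
  if T is Node A B then
    [&& carets A <= (carets B).+1, carets B <= (carets A).+1, balanced A
      & balanced B]
  else true.

(* Evaluated at (t, y), [tword T] is the positive element which merges
   consecutive strands along T; [tpure T] spells the same element, evaluated
   at (y, y ^ t). *)
Fixpoint tword (T : tree) : word bool :=
  if T is Node A B then
    [:: lY false, lTV & tword B] ++ lT :: tword A
  else [::].

Fixpoint tpure (T : tree) : word bool :=
  if T is Node A B then lT :: tword B ++ tpure A else [::].

Lemma carets_flip T : carets (flip T) = carets T.
Proof. by elim: T => //= A -> B ->; rewrite addnC. Qed.

Lemma balanced_flip T : balanced T -> balanced (flip T).
Proof.
elim: T => //= A IA B IB /and4P[ab ba bA bB].
by rewrite !carets_flip ab ba IA ?IB.
Qed.

Lemma balanced_tree g : exists2 T, balanced T & carets T = g.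
Proof.
elim/ltn_ind: g => -[|g] IH; first by exists Leaf.
have [|A bA cA] := IH (g./2); first by lia.
have [|B bB cB] := IH (g - g./2); first by lia.
by exists (Node A B); rewrite /= ?bA ?bB ?cA ?cB ?andbT; lia.
Qed.

Lemma size_tword T : size (tword T) = 3 * carets T.
Proof. by elim: T => //= A IA B IB; rewrite size_cat /= IA IB; lia. Qed.

Lemma size_tpure T : size (tpure T) <= 3 * carets T.
Proof. by elim: T => //= A IA B IB; rewrite size_cat size_tword; lia. Qed.

Section Trees.
Local Open Scope group_scope.
Variables (G : groupType) (N : nat -> G -> Prop).
Hypothesis costN : cost_axioms N.
Notation near := (near N).
Notation tseq := (tseq N).
Implicit Types (x : nat -> G) (c : nat -> nat).

Lemma ev_tword_node (a b : G) A B :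
  ev a b (tword (Node A B)) = b * (ev a b (tword B) ^ a * ev a b (tword A)).
Proof. by rewrite /= /evl /= ev_cat /= /evl /= conjgE !mulgA. Qed.

Lemma ev_tpure_node (a b : G) A B :
  ev a b (tpure (Node A B)) = a * (ev a b (tword B) * ev a b (tpure A)).
Proof. by rewrite /= ev_cat. Qed.

(* The recursion X(A ^ B) = X(A) + 2 X(B) + O(|B|) is quadratic on balanced
   trees because 1 + 2 < 4. *)
Lemma tword_tpure c x T : tseq c x -> balanced T ->
  near (6 * cbound c * (carets T) ^ 2)
    (ev (x 0%N) (x 1%N) (tword T)) (ev (x 1%N) (x 2%N) (tpure T)).
Proof.
set K := cbound c => hx bT; elim: T bT x hx => [|A IA B IB].
  by move=> _ x hx; apply: near_refl.
move=> /and4P[ab ba bA bB] x hx; rewrite ev_tword_node ev_tpure_node /=.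
(* The bound for B enters twice: the word of B at (x_0, x_1) is made pure and conjugated by x_0, and
   the bound for the shifted sequence, read backwards, gives the word of B at (x_1, x_2). *)
have IB0 := IB bB x hx; have IB1 := IB bB (shift x) (tseq_shift hx).
have xs i : (0 < i <= 3)%N -> near K (x i ^ x 0%N) (x i.+1).
  by move=> i3; apply: tseq_near => //; lia.
have sh : near (K * (3 * carets B)) (ev (x 1%N) (x 2%N) (tpure B) ^ x 0%N)
    (ev (x 2%N) (x 3%N) (tpure B)).
  rewrite evJ; apply: (nearW costN (ev_near costN _ (xs 1%N isT) (xs 2%N isT))).
  by have := size_tpure B; nia.
have nB := near_trans costN (near_trans costN (nearJ costN (x 0%N) IB0) sh)
  (near_sym costN IB1).
apply: (nearW costN (nearMl costN _ (nearM costN nB (IA bA x hx)))).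
clear -ab ba; move: (carets A) (carets B) ab ba => a b ab ba.
have e : (6 * (a ^ 2 + 2 * b ^ 2) + 3 * b <= 6 * (a + b).+1 ^ 2)%N by nia.
by move: (leq_mul (leqnn K) e); nia.
Qed.

Section Flip.
Variables (c : nat -> nat) (x : nat -> G).
Hypothesis hx : tseq c x.
Let K := cbound c.
Let x' := mirror x.
Let hx' : tseq (mirror_cost c) x' := tseq_mirror costN hx.
Let K' := cbound (mirror_cost c).

Lemma comm_left_right (v w : word bool) :
  near (4 * K * size v * size w)
    (ev (x 2%N) (x 3%N) v ^ ev (x' 1%N) (x' 2%N) w) (ev (x 2%N) (x 3%N) v).
Proof.
have xz j : (2 <= j <= 4)%N -> near (4 * K) (x j ^ x' 1%N) (x j).
  move=> j4; rewrite /x' mirror1.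
  by apply: (nearW costN (comm_z costN hx _)); lia.
have xzz j : (2 <= j <= 4)%N -> near (4 * K) (x j ^ x' 2%N) (x j).
  by move=> j4; apply: comm_zz.
exact: (ev_ev_comm costN _ _ (xz _ _) (xz _ _) (xzz _ _) (xzz _ _)).
Qed.

(** x_1 ^ x_0 and x_2 ^ x_0 are near x_2 and x_3, which commute with the mirrored generators. This
    form applies directly to a subtree word conjugated by t. *)
Lemma comm_left_shift (v w : word bool) :
  near (6 * K * size v * size w)
    ((ev (x 1%N) (x 2%N) v ^ x 0%N) ^ ev (x' 1%N) (x' 2%N) w)
    (ev (x 1%N) (x 2%N) v ^ x 0%N).
Proof.
have xs j : (1 <= j <= 2)%N -> near K (x j ^ x 0%N) (x j.+1).
  by move=> j2; apply: tseq_near => //; lia.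
have tr k u g h : near k (h ^ u) h -> near K g h -> near (k + 2 * K) (g ^ u) g.
  move=> hu gh.
  have := near_trans costN (near_trans costN (nearJ costN u gh) hu) (near_sym costN gh).
  by move=> H; apply: (nearW costN H); lia.
have xz j : (1 <= j <= 2)%N -> near (6 * K) ((x j ^ x 0%N) ^ x' 1%N) (x j ^ x 0%N).
  move=> j2; rewrite /x' mirror1.
  have jz : near (2 * K) (x j.+1 ^ zof x) (x j.+1) by apply: comm_z => //; lia.
  by apply: (nearW costN (tr _ _ _ _ jz (xs _ j2))); lia.
have xzz j : (1 <= j <= 2)%N -> near (6 * K) ((x j ^ x 0%N) ^ x' 2%N) (x j ^ x 0%N).
  move=> j2.
  have jz : near (4 * K) (x j.+1 ^ x' 2%N) (x j.+1).
    by apply: (comm_zz costN hx _); lia.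
  by apply: (nearW costN (tr _ _ _ _ jz (xs _ j2))); lia.
rewrite evJ.
exact: (ev_ev_comm costN _ _ (xz _ _) (xz _ _) (xzz _ _) (xzz _ _)).
Qed.

(* Building the right subtree before the left one, seen from the right end of
   the tree, gives the mirror word of the flipped tree. *)
Lemma tword_flip T : balanced T ->
  near ((12 * (K + K') + 54 * K) * (carets T) ^ 2)
    (ev (x 0%N) (x 1%N) (tword T) * x 0%N ^- carets T)
    (ev (x' 0%N) (x' 1%N) (tword (flip T))).
Proof.
elim: T => [_|A IA B IB]; first by rewrite /= mulgV; apply: near_refl.
move=> /and4P[ab ba bA bB].
rewrite -[flip _]/(Node (flip B) (flip A)) -[carets _]/(carets A + carets B).+1.
rewrite !ev_tword_node.
set t := x 0%N; set a := carets A; set b := carets B.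
set WA := ev _ _ (tword A); set WB := ev _ _ (tword B).
set WA' := ev _ _ (tword (flip A)); set WB' := ev _ _ (tword (flip B)).
have nA : near _ (WA * t ^- a) WA' := IA bA.
have nB : near _ (WB * t ^- b) WB' := IB bB.
have pB : near _ WB (ev (x 1%N) (x 2%N) (tpure B)) := tword_tpure hx bB.
have pA : near _ WA' (ev (x' 1%N) (x' 2%N) (tpure (flip A))) :=
  tword_tpure hx' (balanced_flip bA).
rewrite carets_flip -/a -/K' in pA; rewrite -/b -/K in pB.
have cAB := comm_left_shift (tpure B) (tpure (flip A)).
(* Once both words are pure, that of B lies on the right and that of the flipped A on the left, so
   they commute; then both rewritings are undone. *)
have swap : near ((6 * K * b ^ 2 + 6 * K' * a ^ 2) * 2 + 54 * K * (a * b))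
    (WB ^ t * WA') (WA' * WB ^ t).
  have n1 := nearM costN (nearJ costN t pB) pA.
  have n2 := near_comm_mul costN cAB.
  have n3 := nearM costN (near_sym costN pA) (near_sym costN (nearJ costN t pB)).
  apply: (nearW costN (near_trans costN (near_trans costN n1 n2) n3)).
  have sA := size_tpure (flip A); have sB := size_tpure B.
  rewrite carets_flip -/a in sA; rewrite -/b in sB.
  have := leq_mul sB sA; move: (size _) (size _) => q p pq.
  suff : (6 * K * p * q <= 54 * K * (a * b))%N by lia.
  have -> : (54 * K * (a * b) = 6 * K * (3 * b * (3 * a)))%N by lia.
  by rewrite -mulnA leq_mul2l pq orbT.
have st1 := nearMr costN (t ^- b.+1) (nearMl costN (x 1%N) (nearMl costN (WB ^ t) nA)).
have st2 := nearMr costN (t ^- b.+1) (nearMl costN (x 1%N) swap).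
have st3 := nearMl costN (x 1%N * WA' * t^-1) nB.
have E1 : x 1%N * (WB ^ t * WA) * t ^- (a + b).+1 =
    x 1%N * (WB ^ t * (WA * t ^- a)) * t ^- b.+1.
  have -> : t ^- (a + b).+1 = t ^- a * t ^- b.+1.
    by rewrite -invgM -expgnDr addnC addSn addnC.
  by rewrite !mulgA.
have E2 : x 1%N * (WA' * WB ^ t) * t ^- b.+1 =
    x 1%N * WA' * t^-1 * (WB * t ^- b).
  rewrite expgS invgM.
  have -> : WB ^ t = t^-1 * WB * t by rewrite conjgE mulgA.
  have -> : t ^- b * t^-1 = t^-1 * t ^- b by rewrite -!invgM -expgS -expgSr.
  by gnorm.
rewrite -E2 in st3; rewrite E1.
have -> : x' 1%N * (WA' ^ x' 0%N * WB') = x 1%N * WA' * t^-1 * WB'.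
  by rewrite /x' mirror1 /zof /=; gnorm.
apply: (nearW costN (near_trans costN (near_trans costN st1 st2) st3)).
move: {cAB swap st1 st2 st3} ab ba; rewrite -/a -/b => ab ba.
have e1 : (2 * (a ^ 2 + b ^ 2) <= (a + b).+1 ^ 2)%N by nia.
have e2 : (2 * (a * b) <= (a + b).+1 ^ 2)%N by nia.
rewrite -/a -/b in nA nB *.
move: K K' (a ^ 2)%N (b ^ 2)%N ((a + b).+1 ^ 2)%N (a * b)%N e1 e2.
by move=> k k' A2 B2 M AB e1 e2; nia.
Qed.

(** By [tword_flip] the tree word times x_0^-g is near a word in [x' 1] and [x' 2], which commute
    with x_2 and x_3. *)
Lemma far_comm T (v : word bool) : balanced T ->
  near ((36 * (K + K') + 200 * K) * (carets T ^ 2 + carets T * size v))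
    (ev (x 2%N) (x 3%N) v ^ ev (x 0%N) (x 1%N) (tword T))
    (ev (x 2%N) (x 3%N) v ^ x 0%N ^+ carets T).
Proof.
move=> bT; set V := ev _ _ v; set W := ev _ _ (tword T); set g := carets T.
have n1 : near _ (W * x 0%N ^- g) _ := tword_flip bT.
have n2 := tword_tpure hx' (balanced_flip bT).
have nc := comm_left_right v (tpure (flip T)).
have n3 := nearJJ costN (near_refl costN 0 V) (near_trans costN n1 n2).
have := nearJ costN (x 0%N ^+ g) (near_trans costN n3 nc).
rewrite -conjgM mulgVK => H; apply: (nearW costN H).
rewrite carets_flip -/g -/K'.
have sp := size_tpure (flip T); rewrite carets_flip -/g in sp.
have := leq_mul (leqnn (size v)) sp; move: (size (tpure _)) (size v) => p s ps.
have e : (4 * K * s * p <= 12 * K * (g * s))%N.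
  have -> : (12 * K * (g * s) = 4 * K * (s * (3 * g)))%N by lia.
  by rewrite -mulnA leq_mul2l ps orbT.
by move: K K' (g ^ 2)%N (g * s)%N e => k k' M AB e; nia.
Qed.

End Flip.
End Trees.

(** * Paths over nonnegative heights *)

(* A word is a path of a pointer along the strands: T^-1 moves it up by one, T
   moves it down by one, and Y acts at the current height. *)
Definition hstep (a : nat) (l : letter bool) : nat :=
  if l.1 then a else if l.2 then a.+1 else a.-1.

Fixpoint hend (a : nat) (w : word bool) : nat :=
  if w is l :: w' then hend (hstep a l) w' else a.

Fixpoint hpath_ok (a : nat) (w : word bool) : bool :=
  if w is l :: w' then ((l == lT) ==> (0 < a)) && hpath_ok (hstep a l) w'
  else true.

Fixpoint touch (a : nat) (w : word bool) : bool :=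
  (a == 0) || (if w is l :: w' then touch (hstep a l) w' else false).

(** In terms of (y, y ^ t) heights drop by one: at height 0 the letter y is T, above it Y stands for
    y ^ t, and the steps between heights 0 and 1 disappear. *)
Definition pure_letter (a : nat) (l : letter bool) : word bool :=
  if l.1 then [:: (a != 0, l.2)] else
  if l.2 then nseq (a != 0) lTV else nseq (1 < a) lT.

(* If all heights are nonnegative, then the value at (t, y) is also a product
   of y and y ^ t, with y moving the pointer between positive heights. *)
Fixpoint pure (a : nat) (w : word bool) : word bool :=
  if w is l :: w' then pure_letter a l ++ pure (hstep a l) w' else [::].

Definition closeup (a : nat) (w : word bool) : word bool :=
  nseq a lTV ++ w ++ nseq (hend a w) lT.

Definition pure_closeup (a : nat) (w : word bool) : word bool :=
  nseq a.-1 lTV ++ pure a w ++ nseq (hend a w).-1 lT.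

Lemma hend_cat a u v : hend a (u ++ v) = hend (hend a u) v.
Proof. by elim: u a => //= l u IH a; rewrite IH. Qed.

Lemma hpath_cat a u v :
  hpath_ok a (u ++ v) = hpath_ok a u && hpath_ok (hend a u) v.
Proof. by elim: u a => //= l u IH a; rewrite IH andbA. Qed.

Lemma pure_cat a u v : pure a (u ++ v) = pure a u ++ pure (hend a u) v.
Proof. by elim: u a => //= l u IH a; rewrite IH catA. Qed.

Lemma touch_cat a u v : touch a (u ++ v) -> touch a u \/ touch (hend a u) v.
Proof.
elim: u a => /= [|l u IH] a; first by right.
by case: (a == 0) => [|/IH[]] /=; [left | left | right].
Qed.

Lemma hstep_addl g a l : (l == lT) ==> (0 < a) ->
  hstep (g + a) l = g + hstep a l.
Proof. by case: l => [[] []] //=; rewrite /hstep /= ?addnS //; lia. Qed.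

Lemma hend_addl g a w : hpath_ok a w -> hend (g + a) w = g + hend a w.
Proof.
by elim: w a => //= l w IH a /andP[la /IH <-]; rewrite hstep_addl.
Qed.

Lemma pure_addl g a w : 0 < g -> hpath_ok a w -> pure (g + a) w = w.
Proof.
move=> g0; elim: w a => //= l w IH a /andP[la /IH Ew].
rewrite hstep_addl // Ew; case: l la {Ew} => [[] e] /=.
  by rewrite /pure_letter /= -lt0n addn_gt0 g0.
case: e => /=; rewrite /pure_letter /=; first by rewrite -lt0n addn_gt0 g0.
by move=> a0; have -> : 1 < g + a by lia.
Qed.

Lemma hpath_descend a w : hpath_ok a.+1 w -> ~~ touch a.+1 w -> hpath_ok a w.
Proof.
elim: w a => //= l w IH a /andP[la ok] nt.
case: l la ok nt => [[] []] //= _; rewrite /hstep /=.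
- exact: IH.
- exact: IH.
- exact: IH.
by case: a => [|a] /=; [case: w {IH} | exact: IH].
Qed.

(** g is the lowest height of the path, which is lowered until it meets 0. *)
Lemma touch_base a w : hpath_ok a w ->
  exists g a', [/\ a = g + a', hpath_ok a' w & touch a' w].
Proof.
elim: a => [|a IH] ok; first by exists 0, 0; split => //; case: (w).
have [tw|nt] := boolP (touch a.+1 w); first by exists 0, a.+1.
by have [g [a' [-> ok' t']]] := IH (hpath_descend ok nt); exists g.+1, a'.
Qed.

Lemma touch_le a w : hpath_ok a w -> touch a w -> a <= size w.
Proof.
elim: w a => [|l w IH] a /=; first by rewrite orbF => _ /eqP ->.
move=> /andP[la ok] /orP[/eqP -> //|/(IH _ ok)].
by case: l la {ok} => [[] []]; rewrite /hstep /=; lia.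
Qed.

Lemma hend_le a w : hend a w <= a + size w.
Proof.
elim: w a => [|l w IH] a /=; first by rewrite addn0.
by apply: leq_trans (IH _) _; case: l => [[] []]; rewrite /hstep /=; lia.
Qed.

Lemma size_pure a w : size (pure a w) <= size w.
Proof.
elim: w a => //= l w IH a; rewrite size_cat -[(size w).+1]add1n leq_add //.
by case: l => [[] []]; rewrite /pure_letter ?size_nseq //=; case: (a) => [|[]].
Qed.

Lemma size_pure_closeup a w : size (pure_closeup a w) <= 2 * (a + size w).
Proof.
rewrite !size_cat !size_nseq; have := size_pure a w; have := hend_le a w; lia.
Qed.

Section Paths.
Local Open Scope group_scope.
Variables (G : groupType) (N : nat -> G -> Prop).
Hypothesis costN : cost_axioms N.
Notation near := (near N).
Notation tseq := (tseq N).
Implicit Types (x : nat -> G) (c : nat -> nat).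

(** A balanced tree with g carets mediates: its word acts on the right like x_0^g, the same tree
    spelled in x_1, x_2 acts like x_1^g, and conjugation by x_0 carries one spelling to the
    other. *)
Lemma far_shift c : exists C, forall x, tseq c x -> forall g v,
  near (C * (g + size v) ^ 2) (ev (x 3%N) (x 4%N) v ^ x 0%N ^+ g)
    (ev (x 3%N) (x 4%N) v ^ x 1%N ^+ g).
Proof.
set K := cbound c; set K' := cbound (mirror_cost c).
exists (200 * (K + K') + 500 * K)%N => x hx g v.
have [T bT cT] := balanced_tree g.
have hs := tseq_shift hx.
have f0 := far_comm costN hx v bT; have f1 := far_comm costN hs v bT.
have p0 := tword_tpure costN hx bT; have p1 := tword_tpure costN hs bT.
rewrite /shift cT -/K -/K' in f0 f1 p0 p1.
set V := ev (x 3%N) (x 4%N) v in f1 *; set V' := ev (x 2%N) (x 3%N) v in f0 *.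
set W0 := ev _ _ _ in f0 p0; set W1 := ev _ _ _ in f1 p1.
have xs i : (0 < i <= 3)%N -> near K (x i ^ x 0%N) (x i.+1).
  by move=> i3; apply: tseq_near => //; lia.
have sV : near (K * size v) (V' ^ x 0%N) V.
  by rewrite /V' evJ; apply: (ev_near costN); apply: xs.
have sP : near (K * (3 * g)) (ev (x 1%N) (x 2%N) (tpure T) ^ x 0%N)
    (ev (x 2%N) (x 3%N) (tpure T)).
  rewrite evJ; apply: (nearW costN (ev_near costN _ (xs 1%N isT) (xs 2%N isT))).
  by rewrite leq_mul2l -cT size_tpure orbT.
have sW := near_trans costN (near_trans costN (nearJ costN (x 0%N) p0) sP)
  (near_sym costN p1).
have s1 := nearJ costN (x 0%N ^+ g) (near_sym costN sV).
have s2 := near_sym costN (nearJ costN (x 0%N) f0).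
rewrite [X in near _ _ X]conjJg in s2.
have E : (V' ^ x 0%N ^+ g) ^ x 0%N = (V' ^ x 0%N) ^ x 0%N ^+ g.
  by rewrite -!conjgM -expgS -expgSr.
rewrite E in s2.
have s3 := nearJJ costN sV sW.
apply: (nearW costN (near_trans costN s1 (near_trans costN s2 (near_trans costN s3 f1)))).
clear; move: (size v) => m.
have e1 : (g <= g ^ 2)%N by nia.
have e2 : (m <= m ^ 2)%N by nia.
have e3 : ((g + m) ^ 2 = g ^ 2 + 2 * (g * m) + m ^ 2)%N by nia.
rewrite e3.
move: (g ^ 2)%N (m ^ 2)%N (g * m)%N e1 e2 {e3} => A B AB; move: K K' => k k'.
by move=> e1 e2; nia.
Qed.

(** Conjugation by x_0 or x_1 raises the indices by one, so powers are traded until [far_shift]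
    applies. The exponents g + 1 and g are the heights of a lifted path before and after [pure]
    lowers it. *)
Lemma far_shift1 c : exists C, forall x, tseq c x -> forall g v,
  near (C * (g + size v) ^ 2) (ev (x 1%N) (x 2%N) v ^ x 0%N ^+ g.+1)
    (ev (x 2%N) (x 3%N) v ^ x 1%N ^+ g).
Proof.
have [C FC] := far_shift c; exists (C + 5 * cbound c)%N => x hx g v.
set K := cbound c.
have xs i j : (i < j <= i + 6)%N -> near K (x j ^ x i) (x j.+1).
  by move=> i3; apply: tseq_near.
have n12 : near (K * size v) (ev (x 1%N) (x 2%N) v ^ x 0%N) (ev (x 2%N) (x 3%N) v).
  by rewrite evJ; apply: (ev_near costN); apply: xs.
have n23 i : (i <= 1)%N ->
    near (K * size v) (ev (x 2%N) (x 3%N) v ^ x i) (ev (x 3%N) (x 4%N) v).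
  by move=> i1; rewrite evJ; apply: (ev_near costN); apply: xs; lia.
case: g => [|g].
  rewrite expg1 expg0 conjg1; apply: (nearW costN n12).
  have : (size v <= size v ^ 2)%N by clear; nia.
  by rewrite add0n -/K; clear; move: (size v) (_ ^ 2)%N => m M; nia.
have n13 := near_trans costN (nearJ costN (x 0%N) n12) (n23 0%N isT).
have s1 := nearJ costN (x 0%N ^+ g) n13.
have s2 := nearJ costN (x 1%N ^+ g) (near_sym costN (n23 1%N isT)).
rewrite -!conjgM -expgS in s2; rewrite -!conjgM -!expgS in s1.
apply: (nearW costN (near_trans costN s1 (near_trans costN (FC x hx g v) s2))).
have e1 : (size v <= (g.+1 + size v) ^ 2)%N by nia.
have e2 : ((g + size v) ^ 2 <= (g.+1 + size v) ^ 2)%N by nia.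
clear -e1 e2; move: (size v) (_ ^ 2)%N (_ ^ 2)%N e1 e2 => m A B e1 e2; nia.
Qed.

Lemma ev_closeup (a b : G) h w :
  ev a b (closeup h w) = a ^- h * ev a b w * a ^+ hend h w.
Proof. by rewrite !ev_cat ev_nseqT ev_nseqTV mulgA. Qed.

Lemma ev_pure_closeup (a b : G) h w :
  ev a b (pure_closeup h w) = a ^- h.-1 * ev a b (pure h w) * a ^+ (hend h w).-1.
Proof. by rewrite !ev_cat ev_nseqT ev_nseqTV mulgA. Qed.

Lemma ev_closeup_cat (a b : G) h u v : ev a b (closeup h (u ++ v)) =
  ev a b (closeup h u) * ev a b (closeup (hend h u) v).
Proof. by rewrite !ev_closeup hend_cat ev_cat; gnorm. Qed.

Lemma ev_pure_closeup_cat (a b : G) h u v : ev a b (pure_closeup h (u ++ v)) =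
  ev a b (pure_closeup h u) * ev a b (pure_closeup (hend h u) v).
Proof. by rewrite !ev_pure_closeup hend_cat pure_cat ev_cat; gnorm. Qed.

Lemma ev_closeup_addl (a b : G) g h w : hpath_ok h w ->
  ev a b (closeup (g + h) w) = ev a b (closeup h w) ^ (a ^+ g).
Proof.
move=> ok; rewrite !ev_closeup hend_addl // [(g + hend _ _)%N]addnC.
by rewrite [(g + h)%N]addnC !expgnDr conjgE; gnorm.
Qed.

Lemma pure_closeup_addl g h w : hpath_ok h w ->
  pure_closeup (g.+1 + h) w = nseq (g + h) lTV ++ w ++ nseq (g + hend h w) lT.
Proof. by move=> ok; rewrite /pure_closeup pure_addl // hend_addl. Qed.

(* Halving a path which touches height 0 leaves one half which touches 0; the
   other half is first treated relative to its lowest height, then moved there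
   by the far shift, and then put back in terms of y, which costs it twice. *)
Lemma path_pure c : exists D, forall x, tseq c x -> forall a w,
  hpath_ok a w -> touch a w ->
  near (D * (size w).-1 ^ 2) (ev (x 0%N) (x 1%N) (closeup a w))
    (ev (x 1%N) (x 2%N) (pure_closeup a w)).
Proof.
(* The bound uses (size w).-1, which vanishes for one letter and is at least halved in each half.
   With 6 size w <= 12 (size w).-1, the constant closes because 3/4 of 1000 plus 12 ^ 2 is below
   1000. *)
have [C FC] := far_shift1 c; exists (1000 * C)%N => x hx a w.
have [n nw] := ubnP (size w); elim: n x hx a w nw => // n IH x hx a w nw ok tw.
have [sw|sw] := leqP (size w) 1.
  apply: (near_eq costN); rewrite ev_closeup ev_pure_closeup.
  have al := touch_le ok tw.
  case: w sw ok tw al {nw} => [|l [|//]] //= _.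
    by move=> _; case: a => //= _ _; gnorm.
  case: l => [[] e] /=; rewrite /hstep /pure_letter /evl /=.
    by case: a => [|a] //= _ _ _; case: e => /=; gnorm.
  case: e; case: a => [|[|a]] //= _ _ _; rewrite /evl /= ?expg0 ?expg1; gnorm => //.
have low y a' v : tseq c y -> (size v < size w)%N -> hpath_ok a' v -> touch a' v ->
    near (1000 * C * (size v).-1 ^ 2) (ev (y 0%N) (y 1%N) (closeup a' v))
      (ev (y 1%N) (y 2%N) (pure_closeup a' v)).
  by move=> hy vw; apply: IH => //; apply: leq_trans vw _.
have high a' v : (size v < size w)%N -> (a' <= 2 * size w)%N -> hpath_ok a' v ->
    near (2 * (1000 * C * (size v).-1 ^ 2) + C * (6 * size w) ^ 2)
      (ev (x 0%N) (x 1%N) (closeup a' v))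
      (ev (x 1%N) (x 2%N) (pure_closeup a' v)).
  move=> vw a'w okv; have [[|g] [b [Ea okb tb]]] := touch_base okv.
    rewrite add0n in Ea; rewrite Ea.
    by apply: (nearW costN (low _ _ _ hx vw okb tb)); lia.
  rewrite Ea ev_closeup_addl // pure_closeup_addl //.
  have l0 := low _ _ _ hx vw okb tb.
  have l1 := low _ _ _ (tseq_shift hx) vw okb tb.
  have s1 := nearJ costN (x 0%N ^+ g.+1) l0.
  have s3 := nearJ costN (x 1%N ^+ g) (near_sym costN l1).
  have s2 := FC x hx g (pure_closeup b v).
  have -> : ev (x 1%N) (x 2%N) (nseq (g + b) lTV ++ v ++ nseq (g + hend b v) lT) =
      ev (x 1%N) (x 2%N) (closeup b v) ^ x 1%N ^+ g.
    by rewrite -ev_closeup_addl // /closeup hend_addl.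
  apply: (nearW costN (near_trans costN s1 (near_trans costN s2 s3))).
  have sp := size_pure_closeup b v.
  have bv := touch_le okb tb.
  have e : (g + size (pure_closeup b v) <= 6 * size w)%N by lia.
  have e2 : ((g + size (pure_closeup b v)) ^ 2 <= (6 * size w) ^ 2)%N.
    by rewrite leq_sqr.
  by have := leq_mul (leqnn C) e2; lia.
have aw := touch_le ok tw.
set m := ((size w)./2)%N.
have szu : size (take m w) = m by rewrite size_takel // /m; lia.
have szv : size (drop m w) = (size w - m)%N by rewrite size_drop.
move: ok tw; rewrite -{1 2 4 5}(cat_take_drop m w).
set u := take m w in szu *; set v := drop m w in szv *.
rewrite hpath_cat ev_closeup_cat ev_pure_closeup_cat => /andP[oku okv] tw.
have hu := hend_le a u.
have luw : (size u < size w)%N by lia.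
have lvw : (size v < size w)%N by lia.
have hiu := high a u luw ltac:(lia) oku.
have hiv := high (hend a u) v lvw ltac:(lia) okv.
have arith : (3 * (1000 * C * (size w - m).-1 ^ 2) + C * (6 * size w) ^ 2 <=
    1000 * C * (size w).-1 ^ 2)%N.
  have e : (3 * (1000 * (size w - m).-1 ^ 2) + (6 * size w) ^ 2
      <= 1000 * (size w).-1 ^ 2)%N.
    have : (2 * (size w - m).-1 <= (size w).-1)%N by lia.
    have : (size w <= 2 * (size w).-1)%N by lia.
    by move: (size w - m).-1%N (size w).-1%N (size w) => p q r; clear; nia.
  by have := leq_mul (leqnn C) e; lia.
have e1 : (1000 * C * (size u).-1 ^ 2 <= 1000 * C * (size w - m).-1 ^ 2)%N.
  by rewrite leq_mul2l leq_sqr szu; lia.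
have e2 : (1000 * C * (size v).-1 ^ 2 <= 1000 * C * (size w - m).-1 ^ 2)%N.
  by rewrite szv.
have [tu|tv] := touch_cat tw.
  apply: (nearW costN (nearM costN (low _ _ _ hx luw oku tu) hiv)).
  move: (1000 * C * (size u).-1 ^ 2)%N (1000 * C * (size v).-1 ^ 2)%N
    (1000 * C * (size w - m).-1 ^ 2)%N (C * (6 * size w) ^ 2)%N
    (1000 * C * (size w).-1 ^ 2)%N arith e1 e2; clear; lia.
apply: (nearW costN (nearM costN hiu (low _ _ _ hx lvw okv tv))).
move: (1000 * C * (size u).-1 ^ 2)%N (1000 * C * (size v).-1 ^ 2)%N
    (1000 * C * (size w - m).-1 ^ 2)%N (C * (6 * size w) ^ 2)%N
    (1000 * C * (size w).-1 ^ 2)%N arith e1 e2; clear; lia.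
Qed.

End Paths.

(** * Products of the y_j as paths, and swapping separated blocks *)

Fixpoint pathw (h : nat) (l : seq nat) : word bool :=
  if l is j :: l' then
    nseq (j - h) lTV ++ nseq (h - j) lT ++ lY false :: pathw j l'
  else nseq h lT.

Lemma hpath_nseqTV h n w : hpath_ok h (nseq n lTV ++ w) = hpath_ok (n + h) w.
Proof. by elim: n h => //= n IH h; rewrite IH /hstep /= addnS. Qed.

Lemma hend_nseqTV h n w : hend h (nseq n lTV ++ w) = hend (n + h) w.
Proof. by elim: n h => //= n IH h; rewrite IH /hstep /= addnS. Qed.

Lemma hpath_nseqT h n w : n <= h -> hpath_ok h (nseq n lT ++ w) = hpath_ok (h - n) w.
Proof.
elim: n h => [|n IH] [|h] //= nh; rewrite ?subn0 //.
by rewrite /hstep /= IH.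
Qed.

Lemma hend_nseqT h n w : n <= h -> hend h (nseq n lT ++ w) = hend (h - n) w.
Proof.
elim: n h => [|n IH] [|h] //= nh; rewrite ?subn0 //.
by rewrite /hstep /= IH.
Qed.

Lemma pathw_ok h l : hpath_ok h (pathw h l) && (hend h (pathw h l) == 0).
Proof.
elim: l h => [|j l IH] h /=.
  by rewrite -[nseq h _]cats0 hpath_nseqT // hend_nseqT //= subnn.
rewrite hpath_nseqTV hend_nseqTV hpath_nseqT ?hend_nseqT; try lia.
rewrite /= /hstep /=; have -> : j - h + h - (h - j) = j by lia.
exact: IH.
Qed.

(** The path only climbs, at most to M, and then descends once. *)
Lemma size_pathw_sorted M h l : path leq h l -> h <= M -> all (leq^~ M) l ->
  size (pathw h l) + h <= 2 * M + size l.
Proof.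
elim: l h => [|j l IH] h /=; first by rewrite size_nseq; lia.
move=> /andP[hj /IH {}IH] hM /andP[jM lM].
by rewrite !size_cat /= !size_nseq; have := IH jM lM; lia.
Qed.

(* Positions from which y_b, ..., the letters of V, are seen from the left of
   strand m once the final shift t^-|V| is distributed over the letters. *)
Fixpoint left_heights (m : nat) (V : seq nat) : seq nat :=
  if V is b :: V' then (m - b) :: left_heights m.+1 V' else [::].

Fixpoint left_of (m : nat) (V : seq nat) : bool :=
  if V is b :: V' then (b <= m) && left_of m.+1 V' else true.

(** Each letter raises the height by at most one; the descents are paid by the growth of b up to M
    and by the final return to 0. *)
Lemma size_left_heights M h b V : path leq b V -> b <= M -> all (leq^~ M) V ->
  left_of (h + b).+1 V ->
  size (pathw h (left_heights (h + b).+1 V)) <= 3 * size V + (M - b) + h.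
Proof.
elim: V h b => [|b' V IH] h b /=; first by rewrite size_nseq; lia.
move=> /andP[bb' /IH {}IH] bM /andP[b'M VM] /andP[b'h lV].
rewrite !size_cat /= !size_nseq.
have := IH ((h + b).+1 - b') b'M VM; rewrite subnK // => /(_ lV); lia.
Qed.

Section Swap.
Local Open Scope group_scope.
Variables (G : groupType) (N : nat -> G -> Prop).
Hypothesis costN : cost_axioms N.
Notation near := (near N).
Notation tseq := (tseq N).

Definition aseq (G : groupType) (t y : G) : nat -> G :=
  fun i => if i is j.+1 then y ^ (t ^+ j) else t.

Definition vprod (G : groupType) (t y : G) (l : seq nat) : G :=
  \prod_(j <- l) y ^ (t ^+ j).

Lemma vprod_cons (t y : G) j l : vprod t y (j :: l) = y ^ (t ^+ j) * vprod t y l.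
Proof. by rewrite /vprod big_cons. Qed.

Lemma vprod_cat (t y : G) l l' : vprod t y (l ++ l') = vprod t y l * vprod t y l'.
Proof. by rewrite /vprod big_cat. Qed.

Lemma vprod_shift (t y : G) e l :
  vprod t y (map (addn e) l) = vprod t y l ^ (t ^+ e).
Proof.
elim: l => [|j l IH] /=; first by rewrite /vprod big_nil conj1g.
by rewrite !vprod_cons IH conjMg -conjgM -expgnDr addnC.
Qed.

Lemma ev_pathw (t y : G) h l : ev t y (pathw h l) = t ^+ h * vprod t y l.
Proof.
elim: l h => [|j l IH] h /=; first by rewrite ev_nseqT /vprod big_nil mulg1.
rewrite !ev_cat ev_cons ev_nseqT ev_nseqTV IH vprod_cons /evl /= conjgE.
rewrite !mulgA; congr (_ * _ * _ * _).
(* Subtraction is truncated, so one of the blocks of lengths j - h and h - j is empty. *)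
have [hj|/ltnW hj] := leqP h j; move: (hj) => /eqP ->; rewrite expg0.
  by rewrite mulg1 -{2}(subnK hj) expgnDr invgM mulVKg.
by rewrite invg1 mul1g -{2}(subnK hj) expgnDr mulgK.
Qed.

(** Both products are read as paths and made pure, one for the sequence and one for its mirror
    image; they are then words in generators with supports on opposite sides. *)
Lemma path_comm c : exists C, forall t y : G, tseq c (aseq t y) ->
  forall n l1 l2, (size (pathw 0 l1) <= n)%N -> (size (pathw 0 l2) <= n)%N ->
  near (C * n ^ 2) ((vprod t y l1 ^ t) ^ vprod t^-1 (y / t) l2)
    (vprod t y l1 ^ t).
Proof.
have [D1 H1] := path_pure costN c.
have [D2 H2] := path_pure costN (mirror_cost c).
set K := cbound c; exists (2 * D1 + 2 * D2 + 6 * K)%N => t y hx n l1 l2.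
set w1 := pathw 0 l1; set w2 := pathw 0 l2 => n1 n2.
have /andP[ok1 /eqP e1] := pathw_ok 0 l1; have /andP[ok2 /eqP e2] := pathw_ok 0 l2.
have t0 w : touch 0 w by case: w.
have := H1 _ hx 0%N w1 ok1 (t0 _).
have := H2 _ (tseq_mirror costN hx) 0%N w2 ok2 (t0 _).
rewrite /pure_closeup /closeup e1 e2 !cats0 mirror1 /zof /=.
rewrite expg0 conjg1 !ev_pathw !mul1g => p2 p1.
have := comm_left_shift costN hx (pure 0 w1) (pure 0 w2).
rewrite mirror1 /zof /= expg0 conjg1 -/K => cc.
have p1t := nearJ costN t p1.
have s1 := nearJJ costN p1t p2.
apply: (nearW costN (near_trans costN (near_trans costN s1 cc) (near_sym costN p1t))).
have sq m : (m <= n)%N -> (m.-1 ^ 2 <= n ^ 2)%N by rewrite leq_sqr; lia.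
have m1 := leq_mul (leqnn D1) (sq _ n1); have m2 := leq_mul (leqnn D2) (sq _ n2).
have m3 : (6 * K * size (pure 0 w1) * size (pure 0 w2) <= 6 * K * n ^ 2)%N.
  rewrite -mulnA leq_mul2l; apply/orP; right.
  by rewrite -mulnn leq_mul // (leq_trans (size_pure _ _)).
move: (D1 * (size w1).-1 ^ 2)%N (D2 * (size w2).-1 ^ 2)%N
  (6 * K * size (pure 0 w1) * size (pure 0 w2))%N (n ^ 2)%N m1 m2 m3.
by clear => A B E q m1 m2 m3; lia.
Qed.

(** Distribute t^-|V| over the letters: y_b t^-1 is z ^ t^b, and the remaining product gets
    conjugated by t^-1, which is why m grows along V. *)
Lemma left_conj (t y : G) m V : left_of m V ->
  (vprod t y V * t ^- size V) ^ (t ^- m) = vprod t^-1 (y / t) (left_heights m V).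
Proof.
elim: V m => [|b V IH] m /=; first by rewrite /vprod !big_nil invg1 mulg1 conj1g.
move=> /andP[bm /IH]; rewrite !vprod_cons => <-.
set W := vprod t y V.
have tt n : t ^ (t ^+ n) = t by rewrite conjgE -expgS expgSr mulKg.
have -> : y ^ (t ^+ b) * W * t ^- (size V).+1 =
    (y / t) ^ (t ^+ b) * (W * t ^- size V) ^ t^-1.
  by rewrite [(y / t) ^ _]conjMg conjVg tt expgS; gnorm.
rewrite [LHS]conjMg -!conjgM expVgn; congr (_ ^ _ * _ ^ _).
  by rewrite -{1}(subnK bm) expgnDr invgM mulVKg.
by rewrite -invgM -expgSr.
Qed.

End Swap.

(** * Merging sorted products *)

(* Merges [map (addn s) u] and v along the relations y_j y_i = y_i y_(j+1). *)
Fixpoint mrg (u : seq nat) : nat -> seq nat -> seq nat :=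
  if u is a :: u' then
    fix mrg_u (s : nat) (v : seq nat) {struct v} : seq nat :=
      if v is b :: v' then
        if a + s <= b then (a + s) :: mrg u' s v else b :: mrg_u s.+1 v'
      else map (addn s) u
  else fun _ v => v.

Lemma mrg_nil u s : mrg u s [::] = map (addn s) u.
Proof. by case: u. Qed.

Lemma mrg_cons a u s b v : mrg (a :: u) s (b :: v) =
  if a + s <= b then (a + s) :: mrg u s (b :: v) else b :: mrg (a :: u) s.+1 v.
Proof. by []. Qed.

Lemma mrg_ind (P : seq nat -> nat -> seq nat -> Prop) :
  (forall s v, P [::] s v) -> (forall u s, P u s [::]) ->
  (forall a u s b v, a + s <= b -> P u s (b :: v) -> P (a :: u) s (b :: v)) ->
  (forall a u s b v, b < a + s -> P (a :: u) s.+1 v -> P (a :: u) s (b :: v)) ->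
  forall u s v, P u s v.
Proof.
move=> P1 P2 P3 P4; elim=> // a u IHu s v; elim: v s => // b v IHv s.
by case: (leqP (a + s) b) => ab; [apply: P3 | apply: P4].
Qed.

Lemma size_mrg u s v : size (mrg u s v) = size u + size v.
Proof.
move: u s v; apply: mrg_ind => [s v|u s|a u s b v ab IH|a u s b v ab IH].
- by [].
- by rewrite mrg_nil size_map addn0.
- by rewrite mrg_cons ab /= IH addSn.
- by rewrite mrg_cons leqNgt ab /= IH addnS.
Qed.

Lemma path_addn s a u : path leq (s + a) (map (addn s) u) = path leq a u.
Proof. by rewrite path_map; apply: eq_path => i j; rewrite /= leq_add2l. Qed.

Lemma mrg_path h u s v : path leq h (map (addn s) u) -> path leq h v ->
  path leq h (mrg u s v).
Proof.
move: u s v h; apply: mrg_ind => [s v|u s|a u s b v ab IH|a u s b v ab IH] h.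
- by [].
- by rewrite mrg_nil.
- rewrite mrg_cons ab /= [(a + s)%N]addnC; rewrite addnC in ab.
  move=> /andP[ha pu] /andP[hb pv].
  by rewrite ha IH //= ab.
- rewrite mrg_cons leqNgt ab /= path_addn => /andP[ha pu] /andP[hb pv].
  rewrite hb; apply: IH => //; rewrite -cat1s map_cat /= path_addn pu andbT; lia.
Qed.

Lemma mrg_sorted u s v : sorted leq u -> sorted leq v -> sorted leq (mrg u s v).
Proof.
move=> su sv; have := @mrg_path 0 u s v.
have p0 w : path leq 0 w = sorted leq w by case: w.
rewrite !p0; apply=> //; rewrite sorted_map.
by apply: sub_sorted su => i j; rewrite /= leq_add2l.
Qed.

Lemma mrg_le M u s v : all (leq^~ M) (mrg u s v) ->
  all (leq^~ M) (map (addn s) u) /\ all (leq^~ M) v.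
Proof.
move: u s v; apply: mrg_ind => [s v|u s|a u s b v ab IH|a u s b v ab IH].
- by [].
- by rewrite mrg_nil.
- by rewrite mrg_cons ab /= addnC => /andP[-> /IH[]].
- rewrite mrg_cons leqNgt ab /= => /andP[bM /IH[/andP[aM uM] vM]].
  split; last by rewrite bM.
  rewrite (leq_trans _ aM) ?leq_add2r //=.
  by apply/allP => _ /mapP[j ju ->]; have /= := allP uM _ (map_f (addn s.+1) ju); lia.
Qed.

Lemma le_mrg M u s v : all (leq^~ M) (map (addn (s + size v)) u) ->
  all (leq^~ M) v -> all (leq^~ M) (mrg u s v).
Proof.
move: u s v; apply: mrg_ind => [s v|u s|a u s b v ab IH|a u s b v ab IH].
- by [].
- by rewrite mrg_nil addn0.
- rewrite mrg_cons ab => /andP[aM uM] bvM.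
  have -> : all (leq^~ M) (a + s :: mrg u s (b :: v)) =
    (a + s <= M) && all (leq^~ M) (mrg u s (b :: v)) by [].
  rewrite IH // andbT; apply: leq_trans aM; rewrite addnC.
  by rewrite leq_add2r leq_addr.
- rewrite mrg_cons leqNgt ab => uM /andP[bM vM].
  have -> : all (leq^~ M) (b :: mrg (a :: u) s.+1 v) =
    (b <= M) && all (leq^~ M) (mrg (a :: u) s.+1 v) by [].
  by rewrite bM IH // addSnnS.
Qed.

(** Each letter of v1 leaves before the letters of u2, hence is smaller than these with their shift
    at that time; [left_of] records this, its bound growing with the shift. The last clause makes
    the predecessor a genuine one. *)
Lemma mrg_split u s v k : sorted leq u -> k <= size u + size v ->
  exists u1 u2 v1 v2, [/\ u = u1 ++ u2, v = v1 ++ v2,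
    take k (mrg u s v) = mrg u1 s v1,
    drop k (mrg u s v) = mrg u2 (s + size v1) v2 &
    forall a, a \in u2 -> left_of (a + s).-1 v1 && ((v1 != [::]) ==> (0 < a + s))].
Proof.
move: u s v k; apply: mrg_ind => [s v|u s|a u s b v ab IH|a u s b v ab IH] k su ks.
- by exists [::], [::], (take k v), (drop k v); rewrite cat_take_drop.
- exists (take k u), (drop k u), [::], [::].
  by rewrite cat_take_drop !mrg_nil map_take map_drop addn0.
- case: k ks => [|k] ks.
    by exists [::], (a :: u), [::], (b :: v); rewrite take0 drop0 /= addn0.
  have [u1 [u2 [v1 [v2 [Eu Ev Et Ed lf]]]]] := IH k (path_sorted su) ks.
  exists (a :: u1), u2, v1, v2; split=> //; first by rewrite Eu.
    rewrite mrg_cons ab [take _ _]/= Et; case: v1 Ev {Et Ed lf} => [|b' v1]; last first.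
      by move=> -[<- _]; rewrite mrg_cons ab.
    by rewrite !mrg_nil /= addnC.
  by rewrite mrg_cons ab.
- case: k ks => [|k] ks.
    by exists [::], (a :: u), [::], (b :: v); rewrite take0 drop0 /= addn0.
  have [|u1 [u2 [v1 [v2 [Eu Ev Et Ed lf]]]]] := IH k su.
    by rewrite addnS in ks.
  exists u1, u2, (b :: v1), v2; split=> //; first by rewrite Ev.
  + rewrite mrg_cons leqNgt ab [take _ _]/= Et; case: u1 Eu {Et Ed lf} => [|a' u1] //.
    by move=> [<- _]; rewrite mrg_cons leqNgt ab.
  + by rewrite mrg_cons leqNgt ab /= Ed addSn addnS.
  + move=> a2 a2u; have aa : a <= a2.
      have : a2 \in a :: u by rewrite Eu mem_cat a2u orbT.
      rewrite inE => /predU1P[-> //|].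
      by move: su => /= /(order_path_min leq_trans) /allP; apply.
    have /andP[l _] := lf _ a2u; rewrite /= addnS in l.
    have e : (a2 + s).-1.+1 = a2 + s by lia.
    by rewrite /= e l andbT; lia.
Qed.

Section Merge.
Local Open Scope group_scope.
Variables (G : groupType) (N : nat -> G -> Prop).
Hypothesis costN : cost_axioms N.
Notation near := (near N).
Notation tseq := (tseq N).

(** After conjugation by t^-m, U is a product conjugated by t and V t^-|V| is a product of mirrored
    letters, so they commute by [path_comm]. Thus V acts on U like t^|V|, which shifts the indices
    by |V|. *)
Lemma swap_blocks c : exists C, forall t y : G, tseq c (aseq t y) ->
  forall n m U V, sorted leq U -> sorted leq V ->
  all (ltn m) U -> all (leq^~ n) U -> all (leq^~ n) V -> left_of m V ->
  (size U <= n)%N -> (size V <= n)%N ->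
  near (C * n ^ 2) (vprod t y U * vprod t y V)
    (vprod t y V * vprod t y (map (addn (size V)) U)).
Proof.
have [C HC] := path_comm costN c.
(* 36 is the square of 6: both paths have length at most 6 n. *)
exists (36 * C)%N => t y hx n m U V sU sV mU Un Vn lV szU szV.
case: U => [|u U] in sU mU Un szU *.
  by rewrite /vprod !big_nil mul1g mulg1; apply: near_refl.
have mn : (m < n)%N by case/andP: mU Un => /= mu _ /andP[]; lia.
set uU := u :: U in sU mU Un szU *.
pose U' := map (subn^~ m.+1) uU.
have EU : vprod t y U' ^ t = vprod t y uU ^ (t ^- m).
  have -> : uU = map (addn m.+1) U'.
    rewrite /U' -map_comp -[LHS]map_id; apply/eq_in_map => j /(allP mU) /= mj.
    by rewrite subnKC.
  by rewrite vprod_shift -conjgM expgS mulgK.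
have sU' : (size (pathw 0 U') <= 6 * n)%N.
  have := @size_pathw_sorted n 0 U'.
  rewrite size_map addn0 => /(_ _ (leq0n n)) H.
  apply: leq_trans (H _ _) _; last by lia.
    have -> : path leq 0 U' = sorted leq U' by case: (U').
    by apply: homo_sorted sU => i j ij; apply: leq_sub2r.
  by rewrite all_map; apply: sub_all Un => j /=; lia.
have sV' : (size (pathw 0 (left_heights m V)) <= 6 * n)%N.
  case: V => [|b V] //= in sV Vn lV szV *.
  move: lV => /andP[bm lV]; case/andP: Vn => bn Vn.
  have := @size_left_heights n (m - b) b V sV bn Vn.
  rewrite subnK // => /(_ lV); rewrite size_cat size_nseq /= subn0; lia.
have := HC t y hx _ _ _ sU' sV'; rewrite -left_conj // EU -conjJg.
move=> /(nearJ costN (t ^+ m)); rewrite !conjgKV => /(nearJ costN (t ^+ size V)).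
rewrite -vprod_shift -!conjgM mulgVK => /(nearMl costN (vprod t y V)).
by rewrite -conjgC => H; apply: (nearW costN H); rewrite expnMn; lia.
Qed.

End Merge.

(** The measure for halving sorted lists. The spread of the indices counts along with the length,
    since a path spelling the product has to cross it. *)
Definition extent (o : seq nat) : nat := size o + (last 0 o - head 0 o).

Lemma mrg_ge_head u s v : sorted leq u -> sorted leq v ->
  all (leq (head 0 (mrg u s v))) (map (addn s) u) /\
  all (leq (head 0 (mrg u s v))) v.
Proof.
have min0 w : sorted leq w -> all (leq (head 0 w)) w.
  by case: w => //= a w /(order_path_min leq_trans) ->; rewrite leqnn.
have minS w : sorted leq w -> all (leq (s + head 0 w)) (map (addn s) w).
  by move=> /min0; rewrite all_map; apply: sub_all => j /=; rewrite leq_add2l.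
case: u => [|a u] su sv; first by split => //; exact: min0.
case: v sv => [|b v] sv; first by split => //; have := minS _ su.
have := min0 _ sv; have := minS _ su; rewrite mrg_cons.
rewrite [head 0 (a :: u)]/= [head 0 (b :: v)]/=.
case: (leqP (a + s) b) => ab uS vS; rewrite [head 0 _]/=; split=> //.
- by rewrite addnC.
- by apply: sub_all vS => j; apply: leq_trans.
- by apply: sub_all uS => j; apply: leq_trans; rewrite addnC ltnW.
Qed.

Lemma sorted_le_last o : sorted leq o -> all (leq^~ (last 0 o)) o.
Proof.
elim: o => //= a o IH po; have so := path_sorted po.
have ao : a <= last a o.
  have /allP := order_path_min leq_trans po; case: (o) => // b o' H.
  by apply: H; rewrite /= mem_last.
by rewrite ao /=; have := IH so; case: (o).
Qed.

(** Take the longest proper prefix of extent at most half. Either a single letter remains, or the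
    next letter overshoots and this bounds the rest. *)
Lemma extent_split o : sorted leq o -> 1 < size o ->
  exists2 k, 0 < k < size o &
    extent (take k o) <= (extent o)./2 /\
    extent (drop k o) <= extent o - (extent o)./2.
Proof.
move=> so szo; set n := extent o.
have En : n = size o + (last 0 o - head 0 o) by [].
pose P k := (0 < k < size o) && (k + (nth 0 o k.-1 - nth 0 o 0) <= n./2).
have P1 : exists k, P k by exists 1; rewrite /P szo subnn /=; lia.
have Pb k : P k -> k <= size o by case/andP=> /andP[_ /ltnW].
case: (ex_maxnP P1 Pb) => k /andP[/andP[k0 ko] kn] kmax.
exists k; first by rewrite k0.
have nthle i j : i <= j -> j < size o -> nth 0 o i <= nth 0 o j.
  move=> ij jo; have := sorted_leq_nth leq_trans leqnn 0 so.
  by move=> /(_ i j); rewrite !inE => H; apply: H => //; exact: leq_ltn_trans jo.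
have h0 : head 0 o = nth 0 o 0 by rewrite nth0.
have l0 : last 0 o = nth 0 o (size o).-1 by rewrite nth_last.
split.
  rewrite /extent -nth_last -nth0 size_takel ?(ltnW ko) // !nth_take //.
  by rewrite prednK.
rewrite /extent -nth_last -nth0 size_drop !nth_drop addn0.
have -> : k + (size o - k).-1 = (size o).-1 by lia.
have [ko1|ko1] := eqVneq k.+1 (size o).
  have -> : (size o).-1 = k by rewrite -ko1.
  rewrite subnn; lia.
have : ~~ P k.+1 by apply/negP => /kmax; rewrite ltnn.
rewrite /P /= [_ < _]ltn_neqAle ko1 ko /= -ltnNge.
have := nthle 0 k (leq0n _) ko; have := nthle k (size o).-1; lia.
Qed.

Lemma left_of_addl e m V : left_of (e + m) (map (addn e) V) = left_of m V.
Proof. by elim: V m => //= b V IH m; rewrite leq_add2l -addnS IH. Qed.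

Section MergeCost.
Local Open Scope group_scope.
Variables (G : groupType) (N : nat -> G -> Prop).
Hypothesis costN : cost_axioms N.
Notation near := (near N).
Notation tseq := (tseq N).

(** Cutting the output in two parts of at most about half the extent also cuts u and v, and it
    remains to move the second part of u past the first part of v: X(n) <= X(n/2) + X(n - n/2) + C
    n^2. *)
Lemma merge_near c : exists D, forall t y : G, tseq c (aseq t y) ->
  forall u s v, sorted leq u -> sorted leq v ->
  near (D * extent (mrg u s v) ^ 2)
    (vprod t y (map (addn s) u) * vprod t y v) (vprod t y (mrg u s v)).
Proof.
have [C HC] := swap_blocks costN c.
exists (4 * C)%N => t y hx u s v su sv.
have [n] := ubnP (extent (mrg u s v)); elim: n u s v su sv => // n IH u s v su sv.
rewrite ltnS => en; set o := mrg u s v in en *.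
have [u0|un0] := eqVneq u [::].
  rewrite u0 /= {1}/vprod big_nil mul1g /o u0.
  exact: near_refl.
have [v0|vn0] := eqVneq v [::].
  rewrite v0 {2}/vprod big_nil mulg1 /o v0 mrg_nil.
  exact: near_refl.
have szo : (1 < size o)%N.
  rewrite /o size_mrg; case: (u) un0 => // a u' _; case: (v) vn0 => // b v' _.
  by rewrite /= addSn addnS.
have so : sorted leq o by apply: mrg_sorted.
have [k /andP[k0 ko] [e1 e2]] := extent_split so szo.
have ko' : (k <= size u + size v)%N by rewrite -(size_mrg u s v) ltnW.
have [u1 [u2 [v1 [v2 [Hu Hv Ht Hd lf]]]]] := mrg_split s su ko'.
rewrite -/o in Ht Hd.
have eo : (1 < extent o)%N by apply: leq_trans szo _; rewrite leq_addr.
have [su1 su2] : sorted leq u1 /\ sorted leq u2.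
  by move: su; rewrite Hu => /cat_sorted2[].
have [sv1 sv2] : sorted leq v1 /\ sorted leq v2.
  by move: sv; rewrite Hv => /cat_sorted2[].
have n1 : near (4 * C * (extent (take k o)) ^ 2)
    (vprod t y (map (addn s) u1) * vprod t y v1) (vprod t y (take k o)).
  rewrite Ht; apply: IH => //; rewrite -Ht; apply: leq_ltn_trans e1 _.
  by apply: leq_trans en; move: eo; clear; lia.
have n2 : near (4 * C * (extent (drop k o)) ^ 2)
    (vprod t y (map (addn (s + size v1)) u2) * vprod t y v2) (vprod t y (drop k o)).
  rewrite Hd; apply: IH => //; rewrite -Hd; apply: leq_ltn_trans e2 _.
  by apply: leq_trans en; move: eo; clear; lia.
have sw : near (C * extent o ^ 2)
    (vprod t y (map (addn s) u2) * vprod t y v1)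
    (vprod t y v1 * vprod t y (map (addn (s + size v1)) u2)).
  have -> : map (addn (s + size v1)) u2 = map (addn (size v1)) (map (addn s) u2).
    by rewrite -map_comp; apply: eq_map => j /=; rewrite addnA (addnC s).
  case Eu2: u2 => [|a u2']; first by rewrite /vprod !big_nil mul1g mulg1; apply: near_refl.
  case Ev1: v1 => [|b v1'].
    rewrite [map (addn (size [::])) _]map_id /vprod !big_nil mul1g mulg1.
    by apply: near_refl.
  (* All indices lie between e and e + extent o; conjugation by t^e reduces to indices between 0 and
     extent o. *)
  rewrite -Eu2 -Ev1; set e := head 0%N o.
  have [gu gv] := mrg_ge_head s su sv; rewrite -/o -/e in gu gv.
  have [lu lv] := mrg_le (sorted_le_last so).
  have eol : (last 0%N o <= e + extent o)%N.
    by rewrite /extent -/e; move: (last _ _) (size _) => l k1; clear -l; lia.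
  pose U := map (subn^~ e) (map (addn s) u2); pose V := map (subn^~ e) v1.
  have EU : map (addn s) u2 = map (addn e) U.
    rewrite /U -[in RHS]map_comp -[LHS]map_id; apply/eq_in_map => j ju /=.
    rewrite subnKC //; apply: (allP gu).
    by rewrite Hu map_cat mem_cat ju orbT.
  have EV : v1 = map (addn e) V.
    rewrite /V -[in RHS]map_comp -[LHS]map_id; apply/eq_in_map => j jv /=.
    by rewrite subnKC //; apply: (allP gv); rewrite Hv mem_cat jv.
  have au2 : a \in u2 by rewrite Eu2 inE eqxx.
  have /andP[] := lf a au2; rewrite {2}Ev1 /= => lv1 as0.
  have be : (e <= b)%N by apply: (allP gv); rewrite Hv Ev1 inE eqxx.
  have bas : (b <= (a + s).-1)%N by move: lv1; rewrite Ev1 /= => /andP[].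
  (* m is one below the first index of the moved block, after lowering by e. *)
  pose m := ((a + s).-1 - e)%N.
  have Em : (a + s).-1 = (e + m)%N by rewrite subnKC // (leq_trans be).
  have eas : (e + m < a + s)%N by rewrite -Em prednK.
  rewrite EU {1 2}EV !vprod_shift.
  have szV : size v1 = size V by rewrite size_map.
  rewrite szV -conjgM -expgnDr addnC [in X in near _ _ X]expgnDr conjgM.
  rewrite -(vprod_shift _ _ (size V)) -!conjMg; apply: (nearJ costN).
  have sub_s w : sorted leq w -> sorted leq (map (subn^~ e) w).
    rewrite sorted_map; apply: sub_sorted => i j; exact: leq_sub2r.
  apply: (HC t y hx (extent o) m).
  - by apply: sub_s; rewrite sorted_map; apply: sub_sorted su2 => i j;
      rewrite /= leq_add2l.
  - exact: sub_s.
  - rewrite !all_map; apply/allP => j ju /=.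
    suff aj : (a <= j)%N.
      by rewrite ltn_subRL (leq_trans eas) // addnC leq_add2l.
    move: ju su2; rewrite Eu2 inE => /predU1P[-> //|ju] /=.
    by move=> /(order_path_min leq_trans) /allP; apply.
  - apply/allP => _ /mapP[j ju ->]; rewrite leq_subLR (leq_trans _ eol) //.
    by apply: (allP lu); rewrite Hu map_cat mem_cat ju orbT.
  - apply/allP => _ /mapP[j ju ->]; rewrite leq_subLR (leq_trans _ eol) //.
    by apply: (allP lv); rewrite Hv mem_cat ju.
  - by rewrite -(left_of_addl e) -EV -Em.
  - rewrite !size_map /extent size_mrg Hu size_cat -!addnA [X in (_ <= X)%N]addnCA.
    exact: leq_addr.
  - rewrite size_map /extent size_mrg Hv size_cat.
    apply: leq_trans (leq_addr _ _); apply: leq_trans (leq_addl _ _).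
    exact: leq_addr.
have -> : vprod t y (map (addn s) u) * vprod t y v =
    vprod t y (map (addn s) u1) *
    (vprod t y (map (addn s) u2) * vprod t y v1) * vprod t y v2.
  by rewrite Hu Hv map_cat !vprod_cat !mulgA.
have s1 := nearMr costN (vprod t y v2) (nearMl costN (vprod t y (map (addn s) u1)) sw).
have s2 := nearM costN n1 n2.
rewrite -[in X in near _ _ X]vprod_cat cat_take_drop !mulgA in s2; rewrite !mulgA in s1.
rewrite !mulgA; apply: (nearW costN (near_trans costN s1 s2)).
have q1 : (extent (take k o) ^ 2 <= (extent o)./2 ^ 2)%N by rewrite leq_sqr.
have q2 : (extent (drop k o) ^ 2 <= (extent o - (extent o)./2) ^ 2)%N by rewrite leq_sqr.
have q3 : (extent o ^ 2 + 4 * (extent o)./2 ^ 2 + 4 * (extent o - (extent o)./2) ^ 2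
   <= 4 * extent o ^ 2)%N.
  by move: eo; clear; move: (extent o) => p p1; nia.
move: (extent (take k o) ^ 2)%N (extent (drop k o) ^ 2)%N q1 q2 q3; clear => p q q1 q2 q3.
have : (extent o ^ 2 + 4 * p + 4 * q <= 4 * extent o ^ 2)%N by lia.
by move=> /(leq_mul (leqnn C)); lia.
Qed.

End MergeCost.

(** * The action on the line *)

Record bij (T : Type) : Type := Bij {
  bfun :> T -> T; binv : T -> T; bfunK : cancel bfun binv; binvK : cancel binv bfun }.

HB.instance Definition _ (T : Type) := gen_eqMixin (bij T).
HB.instance Definition _ (T : Type) := gen_choiceMixin (bij T).

Lemma bij_eq (T : Type) (f g : bij T) : f =1 g -> f = g.
Proof.
case: f g => [f f' fK f'K] [g g' gK g'K] /= /funext fg; subst g.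
have fg' : f' = g' by apply/funext => x; rewrite -{1}(g'K x) fK.
subst g'; congr Bij; exact: Prop_irrelevance.
Qed.

Section BijGroup.
Variable T : Type.
Definition bij1 : bij T := @Bij T id id (fun _ => erefl) (fun _ => erefl).
(** Composition with the right factor applied first. *)
Definition bijM (f g : bij T) : bij T :=
  Bij (can_comp (@bfunK T f) (@bfunK T g)) (can_comp (@binvK T g) (@binvK T f)).
Definition bijV (f : bij T) : bij T := Bij (@binvK T f) (@bfunK T f).

Fact bijMA : associative bijM. Proof. by move=> f g h; apply: bij_eq. Qed.
Fact bij1M : left_id bij1 bijM. Proof. by move=> f; apply: bij_eq. Qed.
Fact bijM1 : right_id bij1 bijM. Proof. by move=> f; apply: bij_eq. Qed.
Fact bijVM : left_inverse bij1 bijV bijM.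
Proof. by move=> f; apply: bij_eq => x /=; exact: bfunK. Qed.
Fact bijMV : right_inverse bij1 bijV bijM.
Proof. by move=> f; apply: bij_eq => x /=; exact: binvK. Qed.

HB.instance Definition _ :=
  isGroup.Build (bij T) bijMA bij1M bijM1 bijVM bijMV.
End BijGroup.

Section Model.
Import GRing.Theory Num.Theory Order.TTheory.
Local Open Scope ring_scope.

(* F acts on the line: t is a translation and y halves [0, 2]. *)
Definition half (x : rat) : rat :=
  if x <= 0 then x else if x <= 2 then x / 2 else x - 1.
Definition double (x : rat) : rat :=
  if x <= 0 then x else if x <= 1 then x * 2 else x + 1.

Fact halfK : cancel half double.
Proof.
move=> x; rewrite /half /double.
case: (lerP x 0) => x0; first by rewrite x0.
case: (lerP x 2) => x2; (case: ifP => h1; last case: ifP => h2); lra.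
Qed.

Fact doubleK : cancel double half.
Proof.
move=> x; rewrite /half /double.
case: (lerP x 0) => x0; first by rewrite x0.
case: (lerP x 1) => x2; (case: ifP => h1; last case: ifP => h2); lra.
Qed.

Definition model_y : bij rat := Bij halfK doubleK.
Definition model_t : bij rat := @Bij rat (fun x => x - 1) (fun x => x + 1)
  (fun x => subrK 1 x) (fun x => addrK 1 x).

Lemma model_tX n x : (model_t ^+ n)%g x = x - n%:R.
Proof.
elim: n => [|n IH]; first by rewrite expg0 subr0.
by rewrite expgS -[LHS]/((model_t ^+ n)%g x - 1) IH -natr1; lra.
Qed.

Lemma model_tXV n x : (model_t ^- n)%g x = x + n%:R.
Proof.
rewrite -[RHS](@bfunK _ (model_t ^+ n)%g) model_tX addrK.
by [].
Qed.

Lemma model_yE n x : (model_y ^ (model_t ^+ n))%g x = half (x - n%:R) + n%:R.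
Proof. by rewrite conjgE /= -model_tX -model_tXV. Qed.

(** With this cost [near] is equality, so the estimates on merging and on relations yield exact
    identities. *)
Lemma exact_cost (G : groupType) :
  cost_axioms (fun (_ : nat) (g : G) => g = 1%g).
Proof.
split=> //= [k l g h -> ->|k g ->|k g u ->].
- by rewrite mulg1.
- by rewrite invg1.
- by rewrite conj1g.
Qed.

Lemma near_exact (G : groupType) k (g h : G) :
  near (fun _ x => x = 1%g) k g h -> g = h.
Proof. exact: divg1_eq. Qed.

Lemma half_lo x : x <= 0 -> half x = x.
Proof. by rewrite /half => ->. Qed.

Lemma half_mid x : 0 <= x <= 2 -> half x = x / 2.
Proof. by move=> /andP[x0 x2]; rewrite /half x2; case: ifP => // xl; lra. Qed.

Lemma half_hi x : 2 <= x -> half x = x - 1.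
Proof. by move=> x2; rewrite /half; repeat (case: ifP => ?); lra. Qed.

(** The pointwise form of y_(n+1) y = y y_(n+2), checked on the intervals where the maps are
    affine. *)
Lemma half_comm n x :
  half (half x - n.+1%:R) + n.+1%:R = half (half (x - n.+2%:R) + n.+2%:R).
Proof.
rewrite -!natr1; have : 0 <= n%:R :> rat by apply: ler0n.
move: (n%:R) => c c0.
have [x0|x0] := lerP x 0.
  rewrite (half_lo x0) (@half_lo (x - (c + 1))) ?(@half_lo (x - _)); try lra.
  by rewrite !subrK half_lo.
have [x2|x2] := lerP x 2.
  rewrite (@half_mid x) ?(@half_lo (x / 2 - _)) ?(@half_lo (x - _)); try lra.
  by rewrite !subrK half_mid; lra.
rewrite (@half_hi x); last by lra.
have -> : x - 1 - (c + 1) = x - (c + 1 + 1) by lra.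
set u := x - _; have ux : u = x - (c + 1 + 1) by [].
have [u0|u0] := lerP u 0; first by rewrite (half_lo u0) half_hi; lra.
have [u2|u2] := lerP u 2.
  by rewrite (@half_mid u) ?half_hi; lra.
by rewrite (@half_hi u) ?half_hi; lra.
Qed.

Lemma model_tseq : tseq (fun (_ : nat) (g : bij rat) => g = 1%g) (fun _ => 0%N)
  (aseq model_t model_y).
Proof.
case=> [|i] d.
  by rewrite /near /= -conjgM -expgSr mulgV.
have -> : aseq model_t model_y (i.+1 + d.+1) =
    ((model_y ^ (model_t ^+ d.+1)) ^ (model_t ^+ i))%g.
  by rewrite /= -conjgM -expgnDr addnC.
have -> : aseq model_t model_y (i.+1 + d.+2) =
    ((model_y ^ (model_t ^+ d.+2)) ^ (model_t ^+ i))%g.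
  by rewrite /= -conjgM -expgnDr addnC.
apply/eqP; rewrite divg_eq1; apply/eqP.
rewrite -conjJg; congr (_ ^ _)%g; apply: (mulgI model_y); rewrite -conjgC.
apply: bij_eq => x; rewrite -[LHS]/((model_y ^ (model_t ^+ d.+1))%g (half x)).
rewrite -[RHS]/(half ((model_y ^ (model_t ^+ d.+2))%g x)) !model_yE.
exact: half_comm.
Qed.

End Model.

(** * Uniqueness of sorted products *)

Notation mprod := (vprod model_t model_y).

Section Uniqueness.
Import GRing.Theory Num.Theory Order.TTheory.
Local Open Scope ring_scope.

Lemma half_le x : half x <= x.
Proof. by rewrite /half; repeat (case: ifP => ?); lra. Qed.

Lemma mprod_cons a p x :
  mprod (a :: p) x = half (mprod p x - a%:R) + a%:R.
Proof. by rewrite vprod_cons -model_yE. Qed.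

Lemma mprod_le p x : mprod p x <= x.
Proof.
elim: p => [|a p IH]; first by rewrite /vprod big_nil.
by rewrite mprod_cons; have := half_le (mprod p x - a%:R); lra.
Qed.

Lemma mprod_fix a p x : all (leq a) p -> x <= a%:R -> mprod p x = x.
Proof.
move=> + xa; elim: p => [|b p IH] /=; first by rewrite /vprod big_nil.
move=> /andP[ab /IH Ep]; rewrite mprod_cons Ep.
have ab' : a%:R <= b%:R :> rat by rewrite ler_nat.
by rewrite half_lo ?subrK //; lra.
Qed.

Lemma mprod_gt a p x : all (leq a) p -> a%:R < x -> a%:R < mprod p x.
Proof.
move=> + ax; elim: p => [|b p IH] /=; first by rewrite /vprod big_nil.
move=> /andP[ab /IH Ep]; rewrite mprod_cons /half.
have : a%:R <= b%:R :> rat by rewrite ler_nat.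
by repeat (case: ifP => ?); lra.
Qed.

Lemma mprod_lt a p x : all (leq a) p -> a%:R < x -> mprod (a :: p) x < x.
Proof.
move=> ap ax; have := mprod_gt ap ax; have := mprod_le p x.
by rewrite mprod_cons /half; repeat (case: ifP => ?); lra.
Qed.

(** The first index a is the left end of the support: points up to a are fixed and points beyond a
    are moved. So equal maps have the same first letter, which is cancelled. *)
Lemma mprod_inj p q : sorted leq p -> sorted leq q -> mprod p = mprod q -> p = q.
Proof.
have lt_neq a b p' q' : path leq a p' -> path leq b q' -> (a < b)%N ->
    mprod (a :: p') <> mprod (b :: q').
  move=> ap bq ab E.
  have := mprod_lt (x := b%:R) (order_path_min leq_trans ap).
  rewrite ltr_nat => /(_ ab); rewrite E (@mprod_fix b) ?ltxx //=.
  by rewrite leqnn (order_path_min leq_trans).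
have nil_neq a p' : path leq a p' -> mprod (a :: p') <> mprod [::].
  move=> ap E; have := mprod_lt (x := a.+1%:R) (order_path_min leq_trans ap).
  by rewrite ltr_nat E /vprod big_nil => /(_ (ltnSn a)); rewrite ltxx.
elim: p q => [|a p IH] [|b q] //= sp sq E.
- by case: (nil_neq _ _ sq).
- by case: (nil_neq _ _ sp).
case: (ltngtP a b) => ab.
- by case: (lt_neq _ _ _ _ sp sq ab).
- by case: (lt_neq _ _ _ _ sq sp ab).
rewrite -ab in E *; congr (_ :: _); apply: IH; rewrite ?(path_sorted sp) ?(path_sorted sq) //.
by move: E; rewrite !vprod_cons => /mulgI.
Qed.

(** Evaluate at 0, which every [mprod] fixes: only the translations act, so m = n. *)
Lemma model_trans m n p q :
  (model_t ^+ m * mprod p * (mprod q)^-1 * model_t ^- n = 1)%g ->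
  m = n /\ mprod p = mprod q.
Proof.
move=> E.
have {}E : (mprod p = model_t ^- m * model_t ^+ n * mprod q)%g.
  have := congr1 (fun g => model_t ^- m * g * model_t ^+ n * mprod q)%g E.
  by gnorm.
have p0 r : mprod r 0 = 0 by apply: (@mprod_fix 0%N) => //; apply/allP.
have mn : m = n.
  have := congr1 (fun g : bij rat => g 0) E; rewrite p0 => /esym.
  rewrite -[LHS]/((model_t ^- m)%g ((model_t ^+ n)%g (mprod q 0))).
  rewrite p0 model_tX model_tXV add0r addrC => /eqP; rewrite subr_eq0 => /eqP e.
  by apply/eqP; rewrite -(@eqr_nat rat) e.
by split=> //; rewrite E mn mulVg mul1g.
Qed.

End Uniqueness.

(** * Homomorphisms from presented groups *)

Section TwoRelations.
Local Open Scope group_scope.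
Variables (G : groupType) (N : nat -> G -> Prop).
Hypothesis costN : cost_axioms N.
Notation near := (near N).
Notation tseq := (tseq N).

(* Writing y_(d+3) = y_(d+2) ^ y_(d+1), each relation follows from two earlier ones. *)
Lemma tseq_of_two c0 (t y : G) :
  near c0 ((y ^ t) ^ y) (y ^ (t ^+ 2)) ->
  near c0 ((y ^ (t ^+ 2)) ^ y) (y ^ (t ^+ 3)) ->
  tseq (fun d => c0 * 4 ^ d)%N (aseq t y).
Proof.
move=> r1 r2; pose Y j := y ^ (t ^+ j).
have YS i j : Y (i + j)%N = Y i ^ (t ^+ j) by rewrite /Y expgnDr conjgM.
have S1 d : near c0 (Y d.+1 ^ Y d) (Y d.+2).
  have := nearJ costN (t ^+ d) r1; rewrite conjJg.
  by rewrite -[y ^ t]/(Y 1%N) -[y ^ (t ^+ 2)]/(Y 2%N) -!YS -[y ^ (t ^+ d)]/(Y d) !addSn.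
have S0 d : near (c0 * 4 ^ d)%N (Y d.+1 ^ Y 0%N) (Y d.+2).
  have Y0 : Y 0%N = y by rewrite /Y expg0 conjg1.
  have [m] := ubnP d; elim: m d => // m IH [|[|d]] dm.
  - by rewrite muln1 Y0.
  - by rewrite Y0; apply: (nearW costN r2); lia.
  (* The cost at d + 2 is at most that at d + 1 plus twice that at d plus 2 c0, which the factor 4
     per step covers. *)
  have h1 := IH d.+1 ltac:(lia); have h0 := IH d ltac:(lia).
  have e1 := nearJ costN (Y 0%N) (near_sym costN (S1 d.+1)).
  rewrite conjJg in e1.
  have e2 := nearJJ costN h1 h0.
  apply: (nearW costN (near_trans costN e1 (near_trans costN e2 (S1 d.+2)))).
  have : (0 < 4 ^ d)%N by rewrite expn_gt0.
  by rewrite !expnS; clear; nia.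
move=> [|i] d; first by apply: (near_eq costN); rewrite /= -conjgM -expgSr.
have := nearJ costN (t ^+ i) (S0 d).
by rewrite conjJg -!YS /= add0n -[_ ^ (t ^+ i)]/(Y i) !addSn !addnS addnC.
Qed.

End TwoRelations.

Section Lifts.
Local Open Scope group_scope.

Definition letter_value (X : choiceType) (H : groupType) (f : X -> H)
  (l : letter X) : H := if l.2 then (f l.1)^-1 else f l.1.

Definition word_value (X : choiceType) (H : groupType) (f : X -> H)
  (w : word X) : H := \prod_(l <- w) letter_value f l.

Definition lift (X : choiceType) (H : groupType) (f : X -> H)
  (g : free_group X) : H := word_value f (fgval g).

Variables (X : choiceType) (H : groupType).
Implicit Types (f : X -> H) (w : word X).

Lemma of_word_fgval (g : free_group X) : of_word (fgval g) = g.
Proof. by apply: val_inj; rewrite /= reduce_id // fgvalP. Qed.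

Lemma word_value_push f l w :
  word_value f (push l w) = letter_value f l * word_value f w.
Proof.
case: w => [|m w] /=; rewrite /word_value ?big_cons ?big_nil //.
case: eqP => [->|_]; last by rewrite !big_cons.
by case: l => [x []]; rewrite /letter_value /= mulgA ?mulVg ?mulgV mul1g.
Qed.

Lemma lift_of_word f w : lift f (of_word w) = word_value f w.
Proof.
rewrite /lift /=; elim: w => //= l w IH.
by rewrite word_value_push IH /word_value big_cons.
Qed.

Lemma liftM f : {morph lift f : g h / g * h >-> g * h}.
Proof.
move=> g h; rewrite -[g]of_word_fgval -[h]of_word_fgval -of_word_cat.
by rewrite !lift_of_word /word_value big_cat.
Qed.

Lemma lift_gen f x : lift f (gen x) = f x.
Proof. by rewrite lift_of_word /word_value big_seq1. Qed.

Section Morphisms.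
Variables (K : groupType) (phi : K -> H).
Hypothesis phiM : {morph phi : g h / g * h >-> g * h}.

Lemma morph1 : phi 1 = 1.
Proof. by apply: (mulgI (phi 1)); rewrite -phiM !mulg1. Qed.

Lemma morphV g : phi g^-1 = (phi g)^-1.
Proof. by apply: (mulgI (phi g)); rewrite -phiM !mulgV morph1. Qed.

Lemma morphJ g h : phi (g ^ h) = phi g ^ phi h.
Proof. by rewrite !conjgE !phiM morphV. Qed.

Lemma morphX g n : phi (g ^+ n) = phi g ^+ n.
Proof. by elim: n => [|n IH]; rewrite ?morph1 // !expgS phiM IH. Qed.

Lemma morph_ev a b u : phi (ev a b u) = ev (phi a) (phi b) u.
Proof.
elim: u => [|l u IH] /=; first exact: morph1.
by rewrite phiM IH; case: l => [[] []]; rewrite /evl /= ?morphV.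
Qed.

Lemma kernel_normal : normal_subgroup [set g | phi g = 1]%classic.
Proof.
split=> /= [|g h pg ph|g pg|g h pg]; first exact: morph1.
- by rewrite phiM pg ph mulg1.
- by rewrite morphV pg invg1.
- by rewrite morphJ pg conj1g.
Qed.

End Morphisms.

Lemma morph_word_value (phi : free_group X -> H) w :
  {morph phi : g h / g * h >-> g * h} ->
  phi (of_word w) = word_value (fun x => phi (gen x)) w.
Proof.
move=> phiM; rewrite of_wordE /word_value.
elim: w => [|[x b] w IH]; first by rewrite !big_nil morph1.
by rewrite !big_cons phiM IH; case: b; rewrite /letter_value /= ?morphV.
Qed.

End Lifts.

Section QuotientLift.
Local Open Scope group_scope.
Variables (X : choiceType) (R : set (free_group X)) (H : groupType).

Definition quot_lift (f : X -> H) (a : quot_group R) : H := lift f (qrepr a).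

Lemma morph_quot (K K' : groupType) (S : set K) (phi : K -> K') g h :
  {morph phi : x y / x * y >-> x * y} -> (forall r, S r -> phi r = 1) ->
  normal_closure S (g / h) -> phi g = phi h.
Proof.
move=> phiM phiS /(_ _ (kernel_normal phiM) phiS) /=.
by rewrite phiM (morphV phiM) => /divg1_eq.
Qed.

Variable f : X -> H.
Hypothesis fR : forall r, R r -> lift f r = 1.

Lemma quot_liftE g : quot_lift f (qproj R g) = lift f g.
Proof.
apply: (morph_quot (liftM f) fR); apply/qprojP; exact: qreprK.
Qed.

Lemma quot_liftM : {morph quot_lift f : a b / a * b >-> a * b}.
Proof.
move=> a b; rewrite -(qreprK a) -(qreprK b) -qprojM !quot_liftE.
exact: liftM.
Qed.

Lemma quot_ext (p q : quot_group R -> H) :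
  {morph p : a b / a * b >-> a * b} -> {morph q : a b / a * b >-> a * b} ->
  (forall x, p (qproj R (gen x)) = q (qproj R (gen x))) -> p =1 q.
Proof.
move=> pM qM pq a; rewrite -(qreprK a) -(of_word_fgval (qrepr a)).
have cM (r : quot_group R -> H) : {morph r : a b / a * b >-> a * b} ->
    {morph (fun g => r (qproj R g)) : a b / a * b >-> a * b}.
  by move=> rM g h; rewrite qprojM rM.
rewrite (morph_word_value _ (cM _ pM)) (morph_word_value _ (cM _ qM)).
by congr word_value; apply/funext => x.
Qed.

End QuotientLift.

(** * Words as fractions *)

Arguments mrg : simpl never.

Lemma all_leW M M' p : M <= M' -> all (leq^~ M) p -> all (leq^~ M') p.
Proof. by move=> MM; apply: sub_all => j /= /leq_trans; apply. Qed.

Lemma extent_le M o : all (leq^~ M) o -> extent o <= size o + M.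
Proof.
case: o => [|a o] //= /andP[aM /allP oM]; rewrite /extent leq_add2l.
apply: leq_trans (leq_subr _ _) _; rewrite /=.
by have := mem_last a o; rewrite inE => /predU1P[-> //|/oM].
Qed.

Section Ore.
Local Open Scope group_scope.

Lemma mrg_exact u v : sorted leq u -> sorted leq v ->
  mprod u * mprod v = mprod (mrg u 0 v).
Proof.
move=> su sv; have [D HD] := merge_near (exact_cost (bij rat)) (fun _ => 0%N).
have := near_exact (HD _ _ model_tseq u 0%N v su sv).
by rewrite map_id.
Qed.

Lemma model_rel a b : (a < b)%N ->
  mprod [:: b; a] = mprod [:: a; b.+1].
Proof.
move=> ab; have := near_exact (model_tseq a.+1 (b - a.+1)).
have -> : (a.+1 + (b - a.+1).+1 = b.+1)%N by lia.
have -> : (a.+1 + (b - a.+1).+2 = b.+2)%N by lia.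
by rewrite /vprod !big_cons !big_nil /= !mulg1 => <-; rewrite -conjgC.
Qed.

(** Insertion sort along y_j y_i = y_i y_(j+1): the element is kept, but indices may grow, so the
    result is no permutation of p. *)
Definition nsort (p : seq nat) : seq nat :=
  foldr (fun a l => mrg [:: a] 0 l) [::] p.

Lemma size_nsort p : size (nsort p) = size p.
Proof. by elim: p => //= a p IH; rewrite size_mrg IH. Qed.

Lemma nsort_sorted p : sorted leq (nsort p).
Proof. by elim: p => //= a p IH; apply: mrg_sorted. Qed.

Lemma mprod_nsort p : mprod (nsort p) = mprod p.
Proof.
elim: p => //= a p IH; rewrite -mrg_exact ?nsort_sorted // IH.
by rewrite -vprod_cat.
Qed.

Lemma nsort_le M p : all (leq^~ M) p -> all (leq^~ (M + size p)%N) (nsort p).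
Proof.
elim: p => //= a p IH /andP[aM /IH pM]; apply: le_mrg.
  by rewrite size_nsort /= andbT; lia.
by apply: all_leW pM; rewrite addnS.
Qed.

(** The letter moves through q: passing a smaller index raises the letter, passing a larger one
    raises that index, and meeting its equal cancels it. *)
Lemma ore_letter A B a q : (a <= A)%N -> all (leq^~ B) q ->
  exists a' q', [/\ mprod (a :: q') = mprod (q ++ a'),
    (size a' <= 1)%N, (size q' <= size q)%N,
    all (leq^~ (A + size q)%N) a' & all (leq^~ B.+1) q'].
Proof.
elim: q a A => [|b q IH] a A aA /=.
  by move=> _; exists [:: a], [::]; rewrite /= addn0 aA.
move=> /andP[bB qB].
have cons2 (d e : nat) l : mprod [:: d, e & l] = mprod [:: d; e] * mprod l.
  by rewrite -vprod_cat.
case: (ltngtP a b) => ab.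
- have [a' [q' [E s1 s2 b1 b2]]] := IH a A aA qB.
  exists a', (b.+1 :: q'); split=> //=.
  + by rewrite cons2 -model_rel // -cons2 vprod_cons E -vprod_cons.
  + by apply: all_leW b1; lia.
  + by rewrite ltnS bB.
- have [a' [q' [E s1 s2 b1 b2]]] := IH a.+1 A.+1 aA qB.
  exists a', (b :: q'); split=> //=.
  + by rewrite cons2 model_rel // -cons2 vprod_cons E -vprod_cons.
  + by rewrite addnS -addSn.
  + by rewrite leqW.
- exists [::], q; split=> //=; first by rewrite cats0 ab.
  by apply: all_leW qB.
Qed.

Lemma ore A B p q : all (leq^~ A) p -> all (leq^~ B) q ->
  exists p' q', [/\ mprod (p ++ q') = mprod (q ++ p'),
    (size p' <= size p)%N, (size q' <= size q)%N,
    all (leq^~ (A + size q)%N) p' & all (leq^~ (B + size p)%N) q'].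
Proof.
elim: p q B => [|a p IH] q B /=.
  by move=> _ qB; exists [::], q; rewrite cats0 addn0 /=; split.
move=> /andP[aA pA] qB.
have [a' [q1 [E1 s1 s2 b1 b2]]] := ore_letter aA qB.
have [p' [q' [E2 s3 s4 b3 b4]]] := IH q1 _ pA b2.
exists (a' ++ p'), q'; split.
- rewrite vprod_cons E2 -vprod_cons -cat_cons vprod_cat E1 -vprod_cat.
  by rewrite catA.
- by rewrite size_cat; lia.
- exact: leq_trans s4 s2.
- by rewrite all_cat b1 (all_leW _ b3) // leq_add2l.
- by rewrite addnS -addSn.
Qed.

End Ore.

Section Core.
Local Open Scope group_scope.
Variables (G : groupType) (N : nat -> G -> Prop).
Hypothesis costN : cost_axioms N.
Notation near := (near N).
Notation tseq := (tseq N).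

(** The common multiple is found in the model. There [mprod_inj] shows that merging p with q' and q
    with p' gives the same list, so two applications of [merge_near] compare the two products in
    G. *)
Lemma common_multiple c : exists D, forall t y : G, tseq c (aseq t y) ->
  forall n p q, sorted leq p -> sorted leq q ->
  (size p <= n)%N -> (size q <= n)%N -> all (leq^~ n) p -> all (leq^~ n) q ->
  exists p' q', [/\ sorted leq p', sorted leq q',
    (size p' <= size p)%N /\ (size q' <= size q)%N,
    all (leq^~ (n + size q + size p)%N) p' /\ all (leq^~ (n + size q + size p)%N) q' &
    near (D * n ^ 2) ((vprod t y q)^-1 * vprod t y p)
      (vprod t y p' * (vprod t y q')^-1)].
Proof.
have [D HD] := merge_near costN c; exists (72 * D)%N => t y hx n p q sp sq szp szq bp bq.
have [p' [q' [E s1 s2 b1 b2]]] := ore bp bq.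
have b1' : all (leq^~ (n + size q + size p)%N) (nsort p').
  by apply: all_leW (nsort_le b1); nlia.
have b2' : all (leq^~ (n + size q + size p)%N) (nsort q').
  by apply: all_leW (nsort_le b2); nlia.
exists (nsort p'), (nsort q'); rewrite !size_nsort; split=> //; try exact: nsort_sorted.
have Em : mrg p 0 (nsort q') = mrg q 0 (nsort p').
  apply: mprod_inj; try by apply: mrg_sorted => //; apply: nsort_sorted.
  by rewrite -!mrg_exact ?nsort_sorted // !mprod_nsort -!vprod_cat.
have m1 := HD t y hx p 0%N _ sp (nsort_sorted q').
have m2 := HD t y hx q 0%N _ sq (nsort_sorted p').
rewrite -Em !map_id in m1 m2.
have := near_trans costN m1 (near_sym costN m2).
set P := vprod _ _ p; set Q := vprod _ _ q.
set P' := vprod _ _ (nsort p'); set Q' := vprod _ _ (nsort q').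
move=> /(nearMl costN Q^-1) /(nearMr costN Q'^-1).
rewrite !mulgA mulgK mulVg mul1g => H; apply: (nearW costN H).
have ex : (extent (mrg p 0 (nsort q')) <= 6 * n)%N.
  have h1 : all (leq^~ (n + size q + size p)%N) (map (addn (size (nsort q'))) p).
    apply/allP => _ /mapP[j /(allP bp) jn ->]; rewrite size_nsort; nlia.
  have := extent_le (le_mrg (s := 0) h1 b2').
  by rewrite size_mrg size_nsort => /leq_trans; apply; nlia.
have : (extent (mrg p 0 (nsort q')) ^ 2 <= 36 * n ^ 2)%N.
  by rewrite -[36%N]/(6 ^ 2)%N -expnMn leq_sqr.
by move=> /(leq_mul (leqnn D)); nlia.
Qed.

Definition fraction (t y : G) a p q b : G :=
  t ^+ a * vprod t y p * (vprod t y q)^-1 * t ^- b.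

Lemma fraction_pad (t y : G) d a p q b :
  fraction t y (d + a) (map (addn d) p) (map (addn d) q) (d + b) =
  fraction t y a p q b.
Proof.
rewrite /fraction !vprod_shift [(d + a)%N]addnC [(d + b)%N]addnC !expgnDr !conjgE.
by gnorm.
Qed.

Lemma fraction_mul (t y : G) a p q b p' q' d :
  fraction t y a p q b * fraction t y b p' q' d =
  t ^+ a * (vprod t y p * ((vprod t y q)^-1 * vprod t y p')) *
  (vprod t y q')^-1 * t ^- d.
Proof. by rewrite /fraction; gnorm. Qed.

Lemma word_fraction c : exists D, forall t y : G, tseq c (aseq t y) ->
  forall w, exists a p q b, [/\ (a <= size w)%N /\ (b <= size w)%N,
    sorted leq p /\ sorted leq q, (size p <= size w)%N /\ (size q <= size w)%N,
    all (leq^~ (20 * size w)%N) p /\ all (leq^~ (20 * size w)%N) q &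
    near (D * (size w) ^ 2) (ev t y w) (fraction t y a p q b)].
Proof.
have [D1 H1] := common_multiple c; have [D2 H2] := merge_near costN c.
(* One level costs at most 400 D1 m^2 for the common multiple of lists bounded by 20 m, and 1000 D2
   m^2 for two merges; the factor 4 closes the halving recursion. *)
exists (4 * (400 * D1 + 2000 * D2))%N => t y hx w.
have [n] := ubnP (size w); elim: n w => // n IH w; rewrite ltnS => wn.
have [sw|sw] := leqP (size w) 1.
  case: w sw {wn} => [|l [|//]] _.
    exists 0%N, [::], [::], 0%N; split=> //.
    by apply: (near_eq costN); rewrite /fraction /vprod !big_nil /=; gnorm.
  case: l => [[] e].
    exists 0%N, (if e then [::] else [:: 0%N]), (if e then [:: 0%N] else [::]), 0%N.
    case: e; split=> //; apply: (near_eq costN);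
      by rewrite /fraction /vprod !big_cons !big_nil /= /evl /= ?conjg1; gnorm.
  exists (~~ e), [::], [::], e; case: e; split=> //; apply: (near_eq costN);
    by rewrite /fraction /vprod !big_nil /= /evl /= ?expg1 ?expg0; gnorm.
set m := size w in sw wn *; set k := (m./2)%N.
have k0 : (0 < k < m)%N by rewrite /k; nlia.
have sz1 : size (take k w) = k by rewrite size_takel //; case/andP: k0 => _ /ltnW.
have sz2 : size (drop k w) = (m - k)%N by rewrite size_drop.
have [|a1 [p1 [q1 [b1 [[ab1 bb1] [sp1 sq1] [zp1 zq1] [ap1 aq1] n1]]]]] := IH (take k w).
  by rewrite sz1; nlia.
have [|a2 [p2 [q2 [b2 [[ab2 bb2] [sp2 sq2] [zp2 zq2] [ap2 aq2] n2]]]]] := IH (drop k w).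
  by rewrite sz2; nlia.
rewrite {}sz1 {}sz2 in ab1 bb1 zp1 zq1 ap1 aq1 n1 ab2 bb2 zp2 zq2 ap2 aq2 n2.
(* Padding makes the inner exponents b1 and a2 equal; at least one of these truncated differences is
   0. *)
pose d1 := (a2 - b1)%N; pose d2 := (b1 - a2)%N.
have Ed : (d1 + b1 = d2 + a2)%N by rewrite /d1 /d2; nlia.
rewrite -(fraction_pad t y d1) in n1; rewrite -(fraction_pad t y d2) in n2.
rewrite -Ed in n2.
have sorted_pad d l : sorted leq l -> sorted leq (map (addn d) l).
  by move=> sl; rewrite sorted_map; apply: sub_sorted sl => i j; rewrite /= leq_add2l.
have all_pad d M l : all (leq^~ M) l -> all (leq^~ (d + M)%N) (map (addn d) l).
  by rewrite all_map; apply: sub_all => j /=; rewrite leq_add2l.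
have d1m : (d1 <= m)%N by rewrite /d1; nlia.
have d2m : (d2 <= m)%N by rewrite /d2; nlia.
set M := (20 * (m - k) + m)%N.
have pad_le d e l : (d <= m)%N -> (e <= 20 * (m - k))%N -> all (leq^~ e) l ->
    all (leq^~ M) (map (addn d) l).
  by move=> dm eM /(all_pad d); apply: all_leW; rewrite /M; nlia.
have km : (20 * k <= 20 * (m - k))%N by rewrite /k; nlia.
move: (sorted_pad d1 _ sp1) (sorted_pad d1 _ sq1) (sorted_pad d2 _ sp2)
  (sorted_pad d2 _ sq2) (pad_le d1 _ _ d1m km ap1) (pad_le d1 _ _ d1m km aq1)
  (pad_le d2 _ _ d2m (leqnn _) ap2) (pad_le d2 _ _ d2m (leqnn _) aq2).
rewrite -(size_map (addn d1)) in zp1; rewrite -(size_map (addn d1)) in zq1.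
rewrite -(size_map (addn d2)) in zp2; rewrite -(size_map (addn d2)) in zq2.
move: (map _ p1) (map _ q1) (map _ p2) (map _ q2) zp1 zq1 zp2 zq2 n1 n2.
move=> {ap1 aq1 ap2 aq2 sp1 sq1 sp2 sq2}.
move=> {}p1 {}q1 {}p2 {}q2 zp1 zq1 zp2 zq2 n1 n2 sp1 sq1 sp2 sq2 ap1 aq1 ap2 aq2.
have mM : (m <= M)%N by rewrite /M; nlia.
have [p' [q' [sp' sq' [zp' zq'] [ap' aq'] nn]]] := H1 t y hx M p2 q1 sp2 sq1
  ltac:(nlia) ltac:(nlia) ap2 aq1.
(* The index bound reproduces itself, since 20 (m - k) + 2 m <= 20 m. *)
pose M' := (M + m)%N.
have sum_m : (size q1 + size p2 <= m)%N by nlia.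
have ap'' : all (leq^~ M') p' by apply: all_leW ap'; rewrite /M'; nlia.
have aq'' : all (leq^~ M') q' by apply: all_leW aq'; rewrite /M'; nlia.
have ap1' : all (leq^~ M') (map (addn (size p')) p1).
  by apply: all_leW (all_pad _ _ _ ap1); rewrite /M'; nlia.
have aq2' : all (leq^~ M') (map (addn (size q')) q2).
  by apply: all_leW (all_pad _ _ _ aq2); rewrite /M'; nlia.
have MM : (M' <= 20 * m)%N by rewrite /M' /M /k; nlia.
have lp := le_mrg (s := 0) ap1' ap''; have lq := le_mrg (s := 0) aq2' aq''.
exists (d1 + a1)%N, (mrg p1 0 p'), (mrg q2 0 q'), (d2 + b2)%N; split.
- by rewrite /d1 /d2; nlia.
- by split; apply: mrg_sorted.
- by rewrite !size_mrg; nlia.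
- by split; [apply: all_leW lp; nlia | apply: all_leW lq; nlia].
have mp := H2 t y hx p1 0%N p' sp1 sp'; have mq := H2 t y hx q2 0%N q' sq2 sq'.
rewrite !map_id in mp mq.
have E1 := nearM costN n1 n2; rewrite fraction_mul -ev_cat cat_take_drop in E1.
have E2 := nearMl costN (t ^+ (d1 + a1)) (nearMr costN ((vprod t y q2)^-1 * t ^- (d2 + b2))
   (nearMl costN (vprod t y p1) nn)).
have E3 := nearMr costN (t ^- (d2 + b2)) (nearMl costN (t ^+ (d1 + a1))
  (nearM costN mp (nearV costN mq))).
rewrite invgM in E3; rewrite !mulgA in E1 E2 E3.
apply: (nearW costN (near_trans costN E1 (near_trans costN E2 E3))).
have szp : (size p1 + size p' <= 2 * m)%N by nlia.
have szq : (size q2 + size q' <= 2 * m)%N by nlia.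
have xp : (extent (mrg p1 0 p') ^ 2 <= 500 * m ^ 2)%N.
  apply: (@leq_trans ((22 * m) ^ 2)); last by rewrite expnMn leq_mul2r orbT.
  rewrite leq_sqr; apply: leq_trans (extent_le lp) _; rewrite size_mrg; nlia.
have xq : (extent (mrg q2 0 q') ^ 2 <= 500 * m ^ 2)%N.
  apply: (@leq_trans ((22 * m) ^ 2)); last by rewrite expnMn leq_mul2r orbT.
  rewrite leq_sqr; apply: leq_trans (extent_le lq) _; rewrite size_mrg; nlia.
have xM : (M ^ 2 <= 400 * m ^ 2)%N.
  by rewrite -[400%N]/(20 ^ 2)%N -expnMn leq_sqr /M /k; nlia.
have km2 : (4 * (k ^ 2 + (m - k) ^ 2) + m ^ 2 <= 4 * m ^ 2)%N.
  by move: sw; rewrite /k; clear; move: m => l; nia.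
move: (leq_mul (leqnn D1) xM) (leq_mul (leqnn D2) xp) (leq_mul (leqnn D2) xq)
  (leq_mul (leqnn (400 * D1 + 2000 * D2)%N) km2).
move: (k ^ 2)%N ((m - k) ^ 2)%N (extent _ ^ 2)%N (extent _ ^ 2)%N (M ^ 2)%N.
by move: (m ^ 2)%N; clear; nia.
Qed.

Variable rho : G -> bij rat.
Hypothesis rhoM : {morph rho : g h / g * h >-> g * h}.
Hypothesis rhoN : forall k g, N k g -> rho g = 1.

(** The fraction near the word is trivial in the model, so uniqueness gives equal exponents and
    equal lists, and the fraction is 1 already in G. *)
Lemma quadratic_filling c : exists D, forall t y : G, tseq c (aseq t y) ->
  rho t = model_t -> rho y = model_y ->
  forall w, rho (ev t y w) = 1 -> N (D * size w ^ 2)%N (ev t y w).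
Proof.
have [D H] := word_fraction c; exists D => t y hx rt ry w rw.
have [a [p [q [b [_ [sp sq] _ _ nw]]]]] := H t y hx w.
have rhoP l : rho (vprod t y l) = mprod l.
  elim: l => [|j l IH]; first by rewrite /vprod !big_nil (morph1 rhoM).
  by rewrite !vprod_cons rhoM IH (morphJ rhoM) (morphX rhoM) rt ry.
have := rhoN nw; rewrite rhoM (morphV rhoM) rw mul1g => /eqP; rewrite invg_eq1 => /eqP.
rewrite /fraction !rhoM !(morphV rhoM) !(morphX rhoM) !rhoP rt => /model_trans[ab /(mprod_inj sp sq) pq].
by move: nw; rewrite /near ab pq /fraction mulgK mulgV invg1 mulg1.
Qed.

End Core.

(** * Generation of F by two elements and its action on the line *)

Section ThompsonGroup.
Local Open Scope group_scope.

Notation F := thompson_group.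
Notation exact1 := (fun (_ : nat) g => g = 1).

Definition xgen (j : nat) : F := qproj thompson_relators (gen j).

Lemma xgen_rel i d : xgen (i + d.+1) ^ xgen i = xgen (i + d.+2).
Proof.
have qM := @qprojM _ thompson_relators.
rewrite /xgen -(morphJ qM); apply/qprojP; apply: sub_normal_closure.
by exists i, (i + d.+1)%N; rewrite !addnS; split => //; rewrite ltnS leq_addr.
Qed.

Lemma xgen_aseq j : xgen j = aseq (xgen 0) (xgen 1) j.
Proof.
case: j => // j; elim: j => [|j IH]; first by rewrite /= conjg1.
rewrite -[RHS]/(xgen 1 ^ (xgen 0 ^+ j.+1)) expgSr conjgM.
by rewrite -[xgen 1 ^ (xgen 0 ^+ j)]/(aseq (xgen 0) (xgen 1) j.+1) -IH -(xgen_rel 0).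
Qed.

Lemma aseq_lift (H : groupType) (a b : H) :
  tseq exact1 (fun _ => 0%N) (aseq a b) ->
  forall r, thompson_relators r -> lift (aseq a b) r = 1.
Proof.
move=> ab _ [i [j [ij ->]]]; have := near_exact (ab i (j - i.+1)%N).
have -> : (i + (j - i.+1).+1 = j)%N by lia.
have -> : (i + (j - i.+1).+2 = j.+1)%N by lia.
rewrite liftM (morphV (liftM _)) (morphJ (liftM _)) !lift_gen => ->.
by rewrite mulgV.
Qed.

Lemma ev_inv (H : groupType) (a b : H) w : exists w', ev a b w' = (ev a b w)^-1.
Proof.
exists (rev (map (@linv _) w)); elim: w => [|l w IH]; first by rewrite invg1.
rewrite /= rev_cons -cats1 ev_cat IH invgM ev_cons mulg1.
by case: l => [[] []]; rewrite /evl /= ?invgK.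
Qed.

Lemma thompson_words (a : F) : exists w, a = ev (xgen 0) (xgen 1) w.
Proof.
have qM := @qprojM _ thompson_relators.
rewrite -(qreprK a) -(of_word_fgval (qrepr a)) (morph_word_value _ qM).
elim: (fgval _) => [|l w [u IH]]; first by exists [::]; rewrite /word_value big_nil.
rewrite /word_value big_cons -/(word_value _ w) IH.
have [v Ev] : exists v, letter_value xgen l = ev (xgen 0) (xgen 1) v.
  have [v Ev] : exists v, xgen l.1 = ev (xgen 0) (xgen 1) v.
    rewrite xgen_aseq; case: l.1 => [|j]; first by exists [:: lT]; rewrite ev_cons mulg1.
    exists (nseq j lTV ++ lY false :: nseq j lT).
    by rewrite ev_cat ev_cons ev_nseqT ev_nseqTV.
  have [v' Ev'] := ev_inv (xgen 0) (xgen 1) v.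
  rewrite /letter_value; case: l.2; last by exists v.
  by exists v'; rewrite Ev Ev'.
by exists (v ++ u); rewrite ev_cat -Ev.
Qed.

Definition thompson_action : F -> bij rat :=
  quot_lift (R := thompson_relators) (aseq model_t model_y).

Lemma thompson_actionM : {morph thompson_action : a b / a * b >-> a * b}.
Proof. exact: quot_liftM (aseq_lift model_tseq). Qed.

Lemma thompson_action_gen j : thompson_action (xgen j) = aseq model_t model_y j.
Proof. by rewrite /thompson_action quot_liftE ?lift_gen //; exact: aseq_lift model_tseq. Qed.

End ThompsonGroup.

(** * The presentation with two relators *)

Section FinitePresentation.
Local Open Scope group_scope.
Notation F := thompson_group.
Notation exact1 := (fun (_ : nat) g => g = 1).

Let g0 : free_group 'I_2 := gen ord0.
Let g1 : free_group 'I_2 := gen ord_max.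

Definition two_relator (i : 'I_2) : free_group 'I_2 :=
  (g1 ^ (g0 ^+ i.+1)) ^ g1 / g1 ^ (g0 ^+ i.+2).

Definition two_presentation : fin_presentation := FinPresentation two_relator.

(** [tseq_of_two] with the exact cost yields the infinite family of relations from the two relators,
    so the evident maps in both directions exist and are inverse on generators. *)
Lemma thompson_finitely_presented : finitely_presented F.
Proof.
exists two_presentation; rewrite /presents /presented_group.
set R := relators (P := two_presentation).
pose q := @qproj _ R.
have qM : {morph q : x y / x * y >-> x * y} := @qprojM _ R.
have tQ : tseq exact1 (fun _ => 0%N) (aseq (q g0) (q g1)).
  have rel (i : 'I_2) : (q g1 ^ (q g0 ^+ i.+1)) ^ q g1 = q g1 ^ (q g0 ^+ i.+2).
    have e : q ((g1 ^ (g0 ^+ i.+1)) ^ g1) = q (g1 ^ (g0 ^+ i.+2)).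
      by apply/qprojP; apply: sub_normal_closure; exists i.
    by move: e; rewrite !(morphJ qM) !(morphX qM).
  have ec := exact_cost (quot_group R).
  have := @tseq_of_two _ _ ec 0 (q g0) (q g1).
  move=> H; apply: H; first by apply: (near_eq ec); exact: (rel ord0).
  by apply: (near_eq ec); exact: (rel ord_max).
pose f (x : 'I_2) := xgen x.
have fR r : R r -> lift f r = 1.
  move=> [i _ <-]; rewrite liftM (morphV (liftM _)) !(morphJ (liftM _)).
  rewrite !(morphX (liftM _)) !lift_gen /f /=.
  rewrite -[xgen 1 ^ (_ ^+ i.+1)]/(aseq (xgen 0) (xgen 1) i.+2).
  rewrite -[xgen 1 ^ (_ ^+ i.+2)]/(aseq (xgen 0) (xgen 1) i.+3) -!xgen_aseq.
  by have := xgen_rel 1 i; rewrite !add1n => ->; rewrite mulgV.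
pose phi := quot_lift (R := R) f.
pose psi := quot_lift (R := thompson_relators) (aseq (q g0) (q g1)).
have psiR := aseq_lift tQ.
have phiM : {morph phi : a b / a * b >-> a * b} := quot_liftM fR.
have psiM : {morph psi : a b / a * b >-> a * b} := quot_liftM psiR.
have psi_x j : psi (xgen j) = aseq (q g0) (q g1) j.
  by rewrite /psi quot_liftE // lift_gen.
have phi_g i : phi (q (gen i)) = xgen i by rewrite /phi quot_liftE // lift_gen.
exists phi => //; exists psi.
  apply: (quot_ext (p := psi \o phi) (q := id)) => //.
    by move=> a b; rewrite /= phiM psiM.
  move=> i; rewrite /= -/(q (gen i)) phi_g psi_x.
  case: i => [[|[|//]] ilt] /=; first by congr (q (gen _)); apply/val_inj.
  by rewrite conjg1; congr (q (gen _)); apply/val_inj.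
apply: (quot_ext (p := phi \o psi) (q := id)) => //.
  by move=> a b; rewrite /= psiM phiM.
move=> j; rewrite -[qproj _ _]/(xgen j) /= psi_x xgen_aseq; case: j => [|j].
  exact: phi_g.
by rewrite /= (morphJ phiM) (morphX phiM) !phi_g.
Qed.

End FinitePresentation.

(** * The two bounds for an arbitrary finite presentation *)

(* (a, b, c) is the unitriangular matrix with a and b next to the diagonal and c
   in the corner. *)
Definition heis : Type := (int * int * int)%type.
HB.instance Definition _ := Choice.on heis.

(** * The Heisenberg group *)

Section Heisenberg.
Local Open Scope ring_scope.
Import GRing.Theory.

Definition heisM (x y : heis) : heis :=
  (x.1.1 + y.1.1, x.1.2 + y.1.2, x.2 + y.2 + x.1.1 * y.1.2).
Definition heis1 : heis := (0, 0, 0).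
Definition heisV (x : heis) : heis := (- x.1.1, - x.1.2, - x.2 + x.1.1 * x.1.2).

Lemma heis_eq (x y : heis) : x.1.1 = y.1.1 -> x.1.2 = y.1.2 -> x.2 = y.2 -> x = y.
Proof. by case: x => [[a b] c]; case: y => [[a' b'] c'] /= -> -> ->. Qed.

Fact heisA : associative heisM.
Proof. by move=> x y z; apply: heis_eq => /=; ring. Qed.
Fact heis1M : left_id heis1 heisM.
Proof. by move=> x; apply: heis_eq => /=; ring. Qed.
Fact heisM1 : right_id heis1 heisM.
Proof. by move=> x; apply: heis_eq => /=; ring. Qed.
Fact heisVM : left_inverse heis1 heisV heisM.
Proof. by move=> x; apply: heis_eq => /=; ring. Qed.
Fact heisMV : right_inverse heis1 heisV heisM.
Proof. by move=> x; apply: heis_eq => /=; ring. Qed.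

HB.instance Definition _ := isGroup.Build heis heisA heis1M heisM1 heisVM heisMV.

Lemma heisE (x y : heis) : (x * y)%g = heisM x y. Proof. by []. Qed.
Lemma heisVE (x : heis) : (x^-1)%g = heisV x. Proof. by []. Qed.

Lemma heis_central (x y : heis) : x.1 = (0, 0) -> (x ^ y)%g = x.
Proof.
move=> x0; rewrite conjgE !heisE heisVE.
by apply: heis_eq; rewrite /= ?x0 /=; ring.
Qed.

Lemma heis_comm (x y : heis) :
  [~ x, y]%g = (0, 0, x.1.1 * y.1.2 - y.1.1 * x.1.2).
Proof.
rewrite commgEl conjgE !heisE !heisVE.
by apply: heis_eq => /=; ring.
Qed.

Lemma heisX (x : heis) n : ((x ^+ n)%g).1 = (x.1.1 *+ n, x.1.2 *+ n).
Proof.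
elim: n => [|n IH] //; rewrite expgS heisE /heisM /= IH /= !mulrS.
by [].
Qed.

Lemma heis_commX (x y : heis) n :
  [~ (x ^+ n)%g, (y ^+ n)%g]%g =
  (0, 0, (x.1.1 * y.1.2 - y.1.1 * x.1.2) *+ (n ^ 2)%N).
Proof.
rewrite heis_comm !heisX /= mulrnBl !mulrnAl !mulrnAr -!mulrnA.
by rewrite mulnn.
Qed.

End Heisenberg.

(** * Filling words over a finite presentation of F *)

Section Presentation.
Local Open Scope group_scope.
Notation F := thompson_group.

(** Lifts of the images of the x_j in Z^2; only the two coordinates next to the diagonal descend to
    F. *)
Definition xheis (j : nat) : heis := if j is 0 then (1%R, 0%R, 0%R) else (0%R, 1%R, 0%R).

Definition thompson_ab (a : F) : int * int := (lift xheis (qrepr a)).1.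

Lemma heis_ab_normal : normal_subgroup [set g | (lift xheis g).1 = (0%R, 0%R)]%classic.
Proof.
have liftX := liftM xheis.
split=> /= [|g h pg ph|g pg|g h pg].
- by rewrite (morph1 liftX).
- by rewrite liftX heisE /heisM /= pg ph /= !GRing.addr0.
- by rewrite (morphV liftX) heisVE /heisV /= pg /= GRing.oppr0.
- by rewrite (morphJ liftX) heis_central.
Qed.

Lemma thompson_abE g : thompson_ab (qproj thompson_relators g) = (lift xheis g).1.
Proof.
have rel : (thompson_relators `<=` [set g | (lift xheis g).1 = (0%R, 0%R)])%classic.
  move=> _ [i [j [ij ->]]] /=; rewrite (liftM xheis) (morphV (liftM xheis)).
  rewrite (morphJ (liftM xheis)) !lift_gen conjgE !heisE !heisVE.
  by case: j ij => // j _; case: i => [|i] /=; rewrite /heisM /heisV /=.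
have /qprojP := qreprK (qproj thompson_relators g).
move=> /(_ _ heis_ab_normal rel) /=.
rewrite (liftM xheis) (morphV (liftM xheis)) heisE heisVE /heisM /heisV /thompson_ab /=.
move: (lift _ _) (lift _ _) => [[a b] c] [[a' b'] c'] /= [e1 e2].
by congr pair; lia.
Qed.

Lemma thompson_abM (a b : F) : thompson_ab (a * b) =
  ((thompson_ab a).1 + (thompson_ab b).1, (thompson_ab a).2 + (thompson_ab b).2)%R.
Proof.
rewrite -(qreprK a) -(qreprK b) -qprojM !thompson_abE (liftM xheis).
by rewrite heisE.
Qed.

Variables (P : fin_presentation) (iso : presented_group (@relators P) -> F).
Hypothesis isoM : {morph iso : a b / a * b >-> a * b}.
Hypothesis iso_bij : bijective iso.

Notation E := (free_group 'I_(ngen P)).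
Notation R := (@relators P).

Definition to_F (g : E) : F := iso (qproj R g).

Lemma to_FM : {morph to_F : g h / g * h >-> g * h}.
Proof. by move=> g h; rewrite /to_F qprojM isoM. Qed.

Lemma to_F1 g : to_F g = 1 <-> normal_closure R g.
Proof.
rewrite -[g in normal_closure _ g]mulg1 -[X in g * X]invg1 -qprojP /to_F.
rewrite -(morph1 isoM); split=> [/(bij_inj iso_bij)|->] //.
Qed.

Lemma to_F_surj (a : F) : exists g, to_F g = a.
Proof.
have [inv _ invK] := iso_bij.
by exists (qrepr (inv a)); rewrite /to_F qreprK invK.
Qed.

Definition fill (k : nat) (g : E) : Prop :=
  exists2 s : seq ('I_(nrel P) * bool * E), (size s <= k)%N & g = \prod_(c <- s) cell c.

Lemma fill_cost : cost_axioms fill.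
Proof.
have cellJ (c : 'I_(nrel P) * bool * E) u : cell c ^ u = cell (c.1, c.2 * u).
  by rewrite /cell /= conjgM.
have cellV (c : 'I_(nrel P) * bool * E) : (cell c)^-1 = cell (c.1.1, ~~ c.1.2, c.2).
  by rewrite /cell /= -conjVg; case: c.1.2; rewrite ?invgK.
split.
- by exists [::]; rewrite ?big_nil.
- move=> k l g h [s sk ->] [r rl ->]; exists (s ++ r); last by rewrite big_cat.
  by rewrite size_cat leq_add.
- move=> k g [s sk ->]; exists (rev [seq (c.1.1, ~~ c.1.2, c.2) | c <- s]).
    by rewrite size_rev size_map.
  elim: s {sk} => [|c s IH]; first by rewrite !big_nil invg1.
  rewrite big_cons invgM IH /= rev_cons -cats1 big_cat big_seq1.
  by rewrite -cellV.
- move=> k g u [s sk ->]; exists [seq (c.1, c.2 * u) | c <- s]; first by rewrite size_map.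
  elim: s {sk} => [|c s IH]; first by rewrite !big_nil conj1g.
  by rewrite /= !big_cons conjMg IH cellJ.
- by move=> k l g kl [s sk ->]; exists s => //; apply: leq_trans kl.
Qed.

Lemma fill_ncl g : normal_closure R g -> exists k, fill k g.
Proof.
rewrite -{1}(of_word_fgval g) => /in_kernelP[k [s [sk gs]]].
by exists k, s; rewrite ?sk // -gs of_word_fgval.
Qed.

Lemma fill_to_F k g : fill k g -> to_F g = 1.
Proof.
move=> [s _ ->]; apply/to_F1.
have [n1 nM nV nJ] := normal_closure_normal R.
elim: s => [|[[i e] u] s IH]; first by rewrite big_nil.
rewrite big_cons; apply: nM => //; apply: nJ => /=.
have ri : normal_closure R (relator i) by apply: sub_normal_closure; exists i.
by case: e => //; exact: nV.
Qed.

Lemma fill_area k w : fill k (of_word w) -> (area w <= k)%N.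
Proof.
move=> kw; have /to_F1 ker := fill_to_F kw.
have [_ amin] := areaP ker; case: kw => s sk sw.
by apply: leq_trans sk; apply: amin; exists s.
Qed.

Lemma area_fill w : in_kernel w -> fill (area w) (of_word w).
Proof. by move=> /areaP[[s [sk sw]] _]; exists s; rewrite ?sk. Qed.

(** Preimages t, y of x_0, x_1 in the free group satisfy the two relations at constant cost, and
    each generator of P is a fixed word in t, y up to constant cost. *)
Lemma area_upper : exists C, forall w : word 'I_(ngen P), in_kernel w ->
  (area w <= C * size w ^ 2)%N.
Proof.
have [t tE] := to_F_surj (xgen 0); have [y yE] := to_F_surj (xgen 1).
have fM := to_FM.
have near_of g h : to_F g = to_F h -> exists k, near fill k g h.
  move=> gh; apply: fill_ncl; apply/to_F1.
  by rewrite fM (morphV fM) gh mulgV.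
have rel i : exists k, near fill k ((y ^ (t ^+ i.+1)) ^ y) (y ^ (t ^+ i.+2)).
  apply: near_of; rewrite !(morphJ fM) !(morphX fM) tE yE.
  rewrite -[xgen 1 ^ (_ ^+ i.+1)]/(aseq (xgen 0) (xgen 1) i.+2).
  rewrite -[xgen 1 ^ (_ ^+ i.+2)]/(aseq (xgen 0) (xgen 1) i.+3) -!xgen_aseq.
  by have := xgen_rel 1 i; rewrite !add1n.
have [k1 r1] := rel 0%N; have [k2 r2] := rel 1%N.
have r1' := nearW fill_cost r1 (leq_addr k2 k1).
have r2' := nearW fill_cost r2 (leq_addl k1 k2).
have ty := tseq_of_two fill_cost r1' r2'.
pose rho g := thompson_action (to_F g).
have rhoM : {morph rho : g h / g * h >-> g * h}.
  by move=> g h; rewrite /rho fM thompson_actionM.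
have rhoN k g : fill k g -> rho g = 1.
  by move=> /fill_to_F gE; rewrite /rho gE (morph1 thompson_actionM).
have [D HD] := quadratic_filling fill_cost rhoM rhoN (fun d => (k1 + k2) * 4 ^ d)%N.
have rt : rho t = model_t by rewrite /rho tE thompson_action_gen.
have ry : rho y = model_y by rewrite /rho yE thompson_action_gen /= conjg1.
have words (l : 'I_(ngen P) * bool) : exists uk : word bool * nat,
    near fill uk.2 (letter_value (@gen _) l) (ev t y uk.1).
  have [u Eu] := thompson_words (to_F (letter_value (@gen _) l)).
  have [|k nk] := near_of (letter_value (@gen _) l) (ev t y u).
    by rewrite (morph_ev fM) tE yE.
  by exists (u, k).
have [U HU] := fin_all_exists words.
(* K bounds the cost and L the length of the rewriting of one letter. *)
pose K := \max_l (U l).2; pose L := \max_l size (U l).1.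
exists (K + D * L ^ 2)%N => w kw.
have [u [su nu]] : exists u, (size u <= L * size w)%N /\
    near fill (K * size w) (of_word w) (ev t y u).
  elim: (w) => [|l v [u [su nu]]].
    by exists [::]; split=> //; apply: near_eq fill_cost _ _ _ _; apply: val_inj.
  exists ((U l).1 ++ u); split.
    rewrite size_cat /= mulnS leq_add //.
    exact: (leq_bigmax (F := fun l => size (U l).1) l).
  have -> : of_word (l :: v) = letter_value (@gen _) l * of_word v.
    by rewrite !of_wordE big_cons.
  rewrite ev_cat /= mulnS; apply: (nearM fill_cost) => //.
  apply: (nearW fill_cost (HU l)).
  exact: (leq_bigmax (F := fun l => (U l).2) l).
have uF : rho (ev t y u) = 1.
  have := rhoN _ _ nu; rewrite rhoM (morphV rhoM) => /divg1_eq <-.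
  by have /to_F1 wF := kw; rewrite /rho wF (morph1 thompson_actionM).
have := HD t y ty rt ry u uF => fu.
have := costM fill_cost nu fu; rewrite mulgVK => /fill_area /leq_trans; apply.
have e1 : (size u ^ 2 <= L ^ 2 * size w ^ 2)%N by rewrite -expnMn leq_sqr.
have e2 : (size w <= size w ^ 2)%N by clear; nia.
by rewrite mulnDl leq_add ?leq_mul2l ?e2 ?orbT // -mulnA leq_mul2l e1 orbT.
Qed.

(** Only the first two coordinates of h factor through F; the central one will measure area. *)
Lemma to_heis_lift : exists h : E -> heis,
  {morph h : a b / a * b >-> a * b} /\ forall g, (h g).1 = thompson_ab (to_F g).
Proof.
pose f (i : 'I_(ngen P)) : heis := (thompson_ab (to_F (gen i)), 0%R).
exists (lift f); split=> [|g]; first exact: liftM.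
rewrite -(of_word_fgval g); elim: (fgval g) => [|[i b] w IH].
  by rewrite !(morph1 (liftM f)) (morph1 to_FM) (thompson_abE 1) (morph1 (liftM xheis)).
rewrite -cat1s of_word_cat liftM to_FM thompson_abM heisE /heisM /= IH.
suff -> : (lift f (of_word [:: (i, b)])).1 = thompson_ab (to_F (of_word [:: (i, b)])).
  by [].
rewrite lift_of_word /word_value big_seq1 /letter_value /=.
case: b; last by [].
have -> : of_word [:: (i, true)] = (gen i)^-1 by rewrite of_wordE big_seq1.
rewrite heisVE (morphV to_FM) /heisV /=.
have := thompson_abM (to_F (gen i)) (to_F (gen i))^-1.
rewrite mulgV (thompson_abE 1) (morph1 (liftM xheis)) /= => -[].
move: (thompson_ab _) (thompson_ab _) => [a b] [c d] /= e1 e2.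
by congr pair; lia.
Qed.

(** A and B spell x_1 / x_0 and x_2, which commute in F. A product of k cells has central coordinate
    at most M k in absolute value, while the commutator of the n-th powers has n^2. *)
Lemma area_lower : exists A B : word 'I_(ngen P), exists M, forall n,
  let w := rev (map (@linv _) (flatten (nseq n A))) ++
    rev (map (@linv _) (flatten (nseq n B))) ++
    flatten (nseq n A) ++ flatten (nseq n B) in
  in_kernel w /\ (n ^ 2 <= M * area w)%N.
Proof.
have fM := to_FM.
have [gA EA] := to_F_surj (xgen 1 / xgen 0); have [gB EB] := to_F_surj (xgen 2).
exists (fgval gA), (fgval gB).
have [h [hM hab]] := to_heis_lift.
pose M := \sum_(i < nrel P) `|(h (relator i)).2|%N.
exists M => n w.
have powE g : of_word (flatten (nseq n (fgval g))) = g ^+ n :> E.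
  by elim: n {w} => [|m IH] //=; rewrite of_word_cat IH of_word_fgval expgS.
have invE (v : word 'I_(ngen P)) : of_word (rev (map (@linv _) v)) = (of_word v)^-1 :> E.
  rewrite !of_wordE; elim: v => [|[i b] v IH]; first by rewrite !big_nil invg1.
  rewrite /= rev_cons -cats1 big_cat big_seq1 IH big_cons invgM /=.
  by case: b; rewrite //= invgK.
have wE : of_word w = [~ gA ^+ n, gB ^+ n].
  by rewrite /w !of_word_cat !invE !powE commgEl conjgE !mulgA.
have comm : commute (to_F gA) (to_F gB).
  rewrite EA EB;   have := xgen_rel 1 0; have := xgen_rel 0 1; rewrite !add0n !add1n => r0 r1.
  have e : xgen 2 ^ (xgen 1 / xgen 0) = xgen 2.
    by rewrite conjgM r1 -r0 conjgK.
  by apply/commute_sym; rewrite /commute conjgC e.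
have ker : in_kernel w.
  apply/to_F1; rewrite wE.
  have -> : to_F [~ gA ^+ n, gB ^+ n] = [~ to_F gA ^+ n, to_F gB ^+ n].
    by rewrite !commgEl fM (morphV fM) (morphJ fM) !(morphX fM).
  by apply/eqP/commgP; apply: commuteX2.
split=> //.
have [s ss ws] := area_fill ker.
pose hp (r : seq ('I_(nrel P) * bool * E)) : heis := h (\prod_(c <- r) cell c).
have bound r : (hp r).1 = (0%R, 0%R) /\ (`|(hp r).2|%N <= M * size r)%N.
  have relc i : (h (relator i)).1 = (0%R, 0%R).
    have ri : to_F (relator i) = 1 by apply/to_F1; apply: sub_normal_closure; exists i.
    by rewrite hab ri (thompson_abE 1) (morph1 (liftM xheis)).
  elim: r => [|[[i e] u] r [IH1 IH2]]; first by rewrite /hp big_nil (morph1 hM).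
  (* Images of relators are central, so the conjugator of a cell disappears. *)
  have hc : h (cell (i, e, u)) = if e then (h (relator i))^-1 else h (relator i).
    rewrite /cell /= (morphJ hM) heis_central; first by case: e; rewrite ?(morphV hM).
    by case: e; rewrite ?(morphV hM) ?heisVE /heisV ?relc //= relc.
  have le : (`|(h (relator i)).2|%N <= M)%N by rewrite /M (bigD1 i) //= leq_addr.
  have c1 : (h (cell (i, e, u))).1 = (0%R, 0%R).
    by rewrite hc; case: e {hc}; rewrite ?heisVE /heisV /= ?relc.
  have c2 : (`|(h (cell (i, e, u))).2|%N <= M)%N.
    rewrite hc; case: e {hc c1} => //; rewrite heisVE /heisV /= relc /=; lia.
  rewrite /hp big_cons hM -/(hp r) heisE /heisM /= c1 IH1 /=; split=> //.
  by rewrite mulnS; lia.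
have [_ b2] := bound s; rewrite /hp -ws wE in b2.
have hc : h [~ gA ^+ n, gB ^+ n] = [~ h gA ^+ n, h gB ^+ n].
  by rewrite !commgEl hM (morphV hM) (morphJ hM) !(morphX hM).
have aB : (h gB).1 = (0%R, 1%R) by rewrite hab EB thompson_abE lift_gen.
have aA : (h gA).1 = ((-1)%R, 1%R).
  rewrite hab EA -(morphV (@qprojM _ thompson_relators)) -qprojM thompson_abE.
  by rewrite liftM (morphV (liftM _)) !lift_gen.
(* The determinant of (-1, 1) and (0, 1) is -1. *)
move: b2; rewrite hc heis_commX aA aB /= => b2.
apply: leq_trans (leq_trans b2 _); last by rewrite leq_mul2l ss orbT.
by lia.
Qed.

End Presentation.

Theorem theorem1 :
  finitely_presented thompson_group /\
  forall (P : fin_presentation) (Phi : nat -> nat),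
    presents P thompson_group -> is_dehn_function P Phi ->
    dehn_equiv Phi (fun n : nat => n ^ 2).
Proof.
split; first exact: thompson_finitely_presented.
move=> P Phi [iso isoM iso_bij] [Phi_iso Phi_min]; split.
  have [C HC] := area_upper isoM iso_bij; exists C.+1; split=> // n.
  have := Phi_min (fun n => C * n ^ 2) _ n => /(_ _) H.
  apply: leq_trans (H _) _.
    by move=> m w kw wm; apply: leq_trans (HC w kw) _; rewrite leq_mul2l leq_sqr wm orbT.
  rewrite expnMn; apply: leq_trans (leq_addr _ _); rewrite mulnA leq_mul2r; apply/orP; right.
  by rewrite -expnS (leq_trans (leqnSn C)) // -{1}[C.+1]expn1 leq_pexp2l.
have [A [B [M HM]]] := area_lower isoM iso_bij.
(* The word has length at most 2 (|A| + |B|) n, and the constant must also dominate M. *)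
exists (M + 2 * (size A + size B)).+1; split=> // n.
set C := (M + _).+1; have [kw le] := HM n; move: kw le.
set w := (_ ++ _) => kw le.
have sw : size w <= C * n.
  rewrite /w !size_cat !size_rev !size_map !size_flatten /shape !map_nseq !sumn_nseq.
  by rewrite /C; nia.
have := Phi_iso _ w kw sw => aw.
apply: leq_trans le _; apply: leq_trans (leq_addr _ _).
by apply: leq_mul => //; rewrite /C; lia.
Qed.
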